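(* Let $\underline{T}=(T_1,T_2,T_3)$ be an anti-commuting triple of invertible contractions on $\mathbb{C}^2$. Then there exist an anti-commuting triple of unitaries $\underline{U}=(U_1,U_2,U_3)$ on a Hilbert space $\mathcal{K}\supseteq\mathbb{C}^2$ and a non-zero scalar $\beta\in\mathbb{C}$ such that $\underline{N}=(\beta U_1,U_2,U_3)$ dilates $\underline{T}$. Moreover, if $\|T_1\|\le\|T_2T_3\|$, then $(T_1,T_2,T_3)$ dilates to an anti-commuting triple of unitaries.
   Context: A tuple $(T_1,\dots,T_k)$ of operators is anti-commuting if $T_iT_j=-T_jT_i$ for $1\le i<j\le k$. A contraction is an operator of norm at most $1$. A tuple $(N_1,\dots,N_k)$ of operators on a Hilbert space $\mathcal{K}$ dilates a tuple $(T_1,\dots,T_k)$ on a Hilbert space $\mathcal{H}$ (equivalently, $(T_1,\dots,T_k)$ dilates to $(N_1,\dots,N_k)$) if there is an isometry $V:\mathcal{H}\to\mathcal{K}$ with $T_1^{m_1}\cdots T_k^{m_k}=V^*N_1^{m_1}\cdots N_k^{m_k}V$ for all non-negative integers $m_1,\dots,m_k$. *)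

(* Defs.v *)
From HB Require Import structures.
From mathcomp Require Import all_boot all_order all_algebra.
From mathcomp Require Import complex.
From mathcomp Require Import all_classical all_reals all_analysis.

Set Implicit Arguments.
Unset Strict Implicit.
Unset Printing Implicit Defensive.

Import Order.TTheory GRing.Theory Num.Theory Num.Def.
Import numFieldNormedType.Exports.

Local Open Scope classical_set_scope.
Local Open Scope ring_scope.

Section InnerProductNorm.
Variables (R : realType) (H : lmodType R[i]) (dot : {dot H for conjC}).

(* [dot x x] is a nonnegative real element of R[i]; its square root is taken
   in R so that norms and suprema of norms are real numbers. *)
Definition dot_norm (x : H) : R := Num.sqrt (complex.Re (dot x x)).

Definition dot_complete : Prop :=
  forall u : nat -> H,
    (forall e : R, 0 < e -> \forall m & n \near \oo, dot_norm (u m - u n) < e) ->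
    exists l : H, dot_norm (u n - l) @[n --> \oo] --> (0 : R).

End InnerProductNorm.

(* The inner product is linear in its first argument and conjugate-linear in
   its second one. *)
Record hilbertType (R : realType) := HilbertType {
  hilbert_sort :> lmodType R[i];
  hdot : {dot hilbert_sort for conjC};
  hilbert_complete : dot_complete hdot
}.

Definition hnorm (R : realType) (H : hilbertType R) (x : H) : R :=
  dot_norm (hdot H) x.

Section EuclideanSpace.
Variables (R : realType) (n : nat).

Local Notation a u j := (complex.Re (u ord0 j)).
Local Notation b u j := (complex.Im (u ord0 j)).

Lemma dotmx_normE (u : 'rV[R[i]]_n) :
  dot_norm (@dotmx R[i] n) u = Num.sqrt (\sum_j (a u j ^+ 2 + b u j ^+ 2)).
Proof.
rewrite /dot_norm -[complex.Re _]/(complex.Re (dotmx u u)) dotmxE mxE.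
congr Num.sqrt.
rewrite (big_morph (@complex.Re R) (id1 := 0) (op1 := +%R)) //; last first.
  by move=> [? ?] [? ?].
apply: eq_bigr => j _; rewrite !mxE.
by case: (u ord0 j) => x y /=; rewrite mulrN opprK !expr2.
Qed.

Lemma le_dotmx_norm (u : 'rV[R[i]]_n) j :
  `|a u j| <= dot_norm (@dotmx R[i] n) u /\
  `|b u j| <= dot_norm (@dotmx R[i] n) u.
Proof.
rewrite dotmx_normE -!sqrtr_sqr (bigD1 j) //=.
set s := \sum_(_ | _) _.
have s0 : 0 <= s by apply: sumr_ge0 => i _; rewrite addr_ge0 ?sqr_ge0.
split; apply: ler_wsqrtr.
  by rewrite -addrA lerDl addr_ge0 ?sqr_ge0.
by rewrite addrAC lerDr addr_ge0 ?sqr_ge0.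
Qed.

Lemma dotmx_complete : dot_complete (@dotmx R[i] n).
Proof.
move=> /= u uC.
pose w k : 'rV[R[i]]_n := u k.
have cvg_coord (f : R[i] -> R) : (forall x y, f (x - y) = f x - f y) ->
    (forall (v : 'rV[R[i]]_n) j, `|f (v ord0 j)| <= dot_norm (@dotmx R[i] n) v) ->
    forall j, exists l : R, f (w k ord0 j) @[k --> \oo] --> l.
  move=> fB fle j.
  suff /cauchy_cvgP fc : cauchy (f (w k ord0 j) @[k --> \oo]).
    by exists (lim (f (w k ord0 j) @[k --> \oo])).
  apply/cauchy_ballP => e e0.
  have := uC e e0; rewrite !near_simpl => uCe.
  apply: filterS uCe => -[p q] /= uCpq; rewrite -ball_normE /= -fB.
  apply: le_lt_trans uCpq.
  have -> : w p ord0 j - w q ord0 j = (u p - u q : 'rV_n) ord0 j by rewrite !mxE.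
  exact: fle.
have re x y : complex.Re (x - y : R[i]) = complex.Re x - complex.Re y.
  by case: x; case: y.
have im x y : complex.Im (x - y : R[i]) = complex.Im x - complex.Im y.
  by case: x; case: y.
have /choice[la laP] :=
  cvg_coord (@complex.Re R) re (fun v j => (le_dotmx_norm v j).1).
have /choice[lb lbP] :=
  cvg_coord (@complex.Im R) im (fun v j => (le_dotmx_norm v j).2).
exists (\row_j (Complex (la j) (lb j))).
under eq_fun do rewrite dotmx_normE.
suff : Num.sqrt (\sum_j ((complex.Re (w k ord0 j) - la j) ^+ 2 +
                         (complex.Im (w k ord0 j) - lb j) ^+ 2)) @[k --> \oo]
       --> Num.sqrt (\sum_(j < n) ((la j - la j) ^+ 2 + (lb j - lb j) ^+ 2)).
  have -> : \sum_(j < n) ((la j - la j) ^+ 2 + (lb j - lb j) ^+ 2) = 0.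
    by rewrite big1 // => j _; rewrite !subrr expr0n addr0.
  rewrite sqrtr0; apply: cvg_trans; apply: near_eq_cvg; near=> k.
  by congr Num.sqrt; apply: eq_bigr => j _; rewrite !mxE re im.
apply: continuous_cvg; first exact: sqrt_continuous.
apply: cvg_big => [|j _]; first exact: add_continuous.
by apply: cvgD; rewrite expr2; apply: cvgM;
  apply: cvgB; (exact: laP || exact: lbP || exact: cvg_cst).
Unshelve. all: by end_near. Qed.

End EuclideanSpace.

Definition Cn (R : realType) (n : nat) : hilbertType R :=
  HilbertType (@dotmx_complete R n).

Section Operators.
Variables (R : realType) (H K : hilbertType R).

(* The supremum is taken in the extended reals, so that unbounded linear maps
   have norm +oo. *)
Definition opnorm (T : {linear H -> K}) : \bar R :=
  ereal_sup [set (hnorm (T x))%:E | x in [set x | hnorm x <= 1]].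

Definition contraction_op (T : {linear H -> K}) : Prop := (opnorm T <= 1)%E.

Definition is_adjoint (T : {linear H -> K}) (S : {linear K -> H}) : Prop :=
  forall x y, hdot K (T x) y = hdot H x (S y).

End Operators.

Section Tuples.
Variables (R : realType) (H : hilbertType R).

Definition invertible_op (T : {linear H -> H}) : Prop :=
  exists S : {linear H -> H},
    [/\ (opnorm S < +oo)%E, cancel S T & cancel T S].

(* U U^* = U^* U = 1 *)
Definition unitary_op (U : {linear H -> H}) : Prop :=
  exists Us : {linear H -> H},
    [/\ is_adjoint U Us, cancel Us U & cancel U Us].

Definition anticommuting (k : nat) (T : k.-tuple {linear H -> H}) : Prop :=
  forall i j : 'I_k, (i < j)%N ->
    forall x, tnth T i (tnth T j x) = - tnth T j (tnth T i x).

(* T_1^{m_1} ... T_k^{m_k}, the factors being composed in this order *)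
Definition monomial_op (k : nat) (T : k.-tuple {linear H -> H})
    (m : k.-tuple nat) : H -> H :=
  \big[(fun f g => f \o g)/idfun]_(i < k) iter (tnth m i) (tnth T i).

End Tuples.

(* T^m = V^* N^m V for an isometry V; [Vs] is V^*. *)
Definition dilates (R : realType) (H K : hilbertType R) (k : nat)
    (N : k.-tuple {linear K -> K}) (T : k.-tuple {linear H -> H}) : Prop :=
  exists (V : {linear H -> K}) (Vs : {linear K -> H}),
    [/\ isometry (hdot K) (hdot H) V, is_adjoint V Vs
      & forall (m : k.-tuple nat) (x : H),
          monomial_op T m x = Vs (monomial_op N m (V x))].

(* Main.v *)
(* On C^2 the product T1 (T2 T3)^-1 commutes with the anti-commuting invertible
   pair T2, T3, hence is a scalar beta, and T1 = beta T2 T3.  So it suffices to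
   dilate (T2, T3) to an anti-commuting pair of unitaries (U2, U3) and to take
   U1 = U2 U3; when |beta| <= 1 the scalar beta is itself dilated by a bilateral
   shift.

   The operator A = T2 T3 satisfies A^2 = gamma for a scalar gamma.  If
   |gamma| >= 1 then T2 and T3 are already unitary.  Otherwise A*^n -> 0 and
   x |-> (D A*^n x)_{n >= 0} is an isometry of C^2 into l^2(Z, C^4), where
   D x = (D_2 T3* x, D_3 x) with D_i* D_i = 1 - T_i T_i*.  As in Ando's theorem,
   D' x = (D_3 T2* x, D_2 x) has the same Gram form as D, so D' = G D for a
   unitary G of C^4.  In the manner of Berger, Coburn and Lebow, U2 and U3 are
   multiplications by G* (P - z Q) and (P + z Q) G, where P and Q carry the two
   halves of C^4 to each other, followed by the sign (-1)^n in degree n, which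
   turns commutation into anti-commutation. *)
From HB Require Import structures.
Require Import Defs.
From mathcomp Require Import all_boot all_order all_algebra.
From mathcomp Require Import complex.
From mathcomp Require Import all_classical all_reals all_analysis.
From mathcomp Require Import ring lra zify.

Set Implicit Arguments.
Unset Strict Implicit.
Unset Printing Implicit Defensive.

Import Order.TTheory GRing.Theory Num.Theory Num.Def.
Import numFieldNormedType.Exports.

Local Open Scope classical_set_scope.
Local Open Scope ring_scope.

(** * Complex parts and inner products *)

Section ComplexParts.
Variable R : realType.
Implicit Types z w : R[i].

Lemma complex_ReD z w : complex.Re (z + w) = complex.Re z + complex.Re w.
Proof. by case: z w => [? ?] []. Qed.

Lemma complex_ImD z w : complex.Im (z + w) = complex.Im z + complex.Im w.
Proof. by case: z w => [? ?] []. Qed.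

Lemma complex_ReN z : complex.Re (- z) = - complex.Re z.
Proof. by case: z. Qed.

Lemma complex_ReM z w : complex.Re (z * w) =
  complex.Re z * complex.Re w - complex.Im z * complex.Im w.
Proof. by case: z w => [? ?] []. Qed.

Lemma complex_ImM z w : complex.Im (z * w) =
  complex.Re z * complex.Im w + complex.Im z * complex.Re w.
Proof. by case: z w => [? ?] []. Qed.

Lemma complex_Re_conj z : complex.Re (z^*)%R = complex.Re z.
Proof. by case: z. Qed.

Lemma complex_Im_conj z : complex.Im (z^*)%R = - complex.Im z.
Proof. by case: z. Qed.

Lemma complex_ext z w :
  complex.Re z = complex.Re w -> complex.Im z = complex.Im w -> z = w.
Proof. by case: z w => [? ?] [? ?] /= -> ->. Qed.

(** The squared modulus with values in [R], so that estimates take place in a totally ordered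
    field. *)
Definition sqrmod z : R := complex.Re z ^+ 2 + complex.Im z ^+ 2.

Lemma sqrmodE z : (sqrmod z)%:C%C = z * (z^*)%R.
Proof. by rewrite /sqrmod add_Re2_Im2 normCK. Qed.

Lemma sqrmod_conj z : sqrmod (z^*)%R = sqrmod z.
Proof. by rewrite /sqrmod complex_Re_conj complex_Im_conj sqrrN. Qed.

Lemma sqrmod_ge0 z : 0 <= sqrmod z.
Proof. by rewrite addr_ge0 ?sqr_ge0. Qed.

End ComplexParts.

(** * Norm estimates and polarization in a Hilbert space *)

Section HilbertBasics.
Variables (R : realType) (H : hilbertType R).
Implicit Types (x y : H) (c : R[i]).

Definition sqrnorm x : R := complex.Re (hdot H x x).

Lemma hdotE x : hdot H x x = (sqrnorm x)%:C%C.
Proof.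
apply: complex_ext => //=.
have := dnorm_ge0 (hdot H) x; rewrite lecE => /andP[/eqP-> _] //.
Qed.

Lemma sqrnorm_ge0 x : 0 <= sqrnorm x.
Proof. by rewrite -ler0c -hdotE dnorm_ge0. Qed.

Lemma sqrnorm_eq0 x : (sqrnorm x == 0) = (x == 0).
Proof. by rewrite -(dnorm_eq0 (hdot H)) hdotE eq_complex /= eqxx andbT. Qed.

Lemma sqrnorm0 : sqrnorm 0 = 0.
Proof. by apply/eqP; rewrite sqrnorm_eq0. Qed.

Lemma hdotC x y : hdot H y x = (hdot H x y)^*.
Proof. by rewrite hermC expr0 mul1r. Qed.

Lemma hdotDl x y z : hdot H (x + y) z = hdot H x z + hdot H y z.
Proof. exact: linearDl. Qed.

Lemma hdotDr x y z : hdot H z (x + y) = hdot H z x + hdot H z y.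
Proof. exact: linearDr. Qed.

Lemma hdotZl c x y : hdot H (c *: x) y = c * hdot H x y.
Proof. exact: linearZl_LR. Qed.

Lemma hdotZr c x y : hdot H x (c *: y) = c^* * hdot H x y.
Proof. exact: linearZr_LR. Qed.

Lemma hdot0l x : hdot H 0 x = 0.
Proof. exact: linear0l. Qed.

Lemma hdot0r x : hdot H x 0 = 0.
Proof. exact: linear0r. Qed.

Lemma hdotNr x y : hdot H x (- y) = - hdot H x y.
Proof. exact: linearNr. Qed.

Lemma hdotNl x y : hdot H (- x) y = - hdot H x y.
Proof. exact: linearNl. Qed.

Lemma hdot_inj x y : (forall z, hdot H x z = hdot H y z) -> x = y.
Proof.
move=> xy; apply/eqP; rewrite -subr_eq0 -(dnorm_eq0 (hdot H)).
by rewrite hdotDl hdotNl xy subrr.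
Qed.

Lemma sqrnormD x y :
  sqrnorm (x + y) = sqrnorm x + sqrnorm y + 2 * complex.Re (hdot H x y).
Proof.
rewrite /sqrnorm hdotDl !hdotDr !complex_ReD (hdotC x y) complex_Re_conj; ring.
Qed.

Lemma sqrnormZ c x : sqrnorm (c *: x) = sqrmod c * sqrnorm x.
Proof.
rewrite {1}/sqrnorm hdotZl hdotZr mulrA -sqrmodE hdotE.
by rewrite complex_ReM /= mul0r subr0.
Qed.

Lemma sqrnormN x : sqrnorm (- x) = sqrnorm x.
Proof. by rewrite /sqrnorm hdotNl hdotNr opprK. Qed.

(** Expanding the squares of [x + y] and [x - y] gives this even with a factor 2 on the left; the
    crude form suffices for summability. *)
Lemma Re_hdot_le x y : `|complex.Re (hdot H x y)| <= sqrnorm x + sqrnorm y.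
Proof.
have := sqrnorm_ge0 (x + y); have := sqrnorm_ge0 (x - y).
rewrite !sqrnormD sqrnormN hdotNr complex_ReN ler_norml.
have := sqrnorm_ge0 x; have := sqrnorm_ge0 y => *; apply/andP; split; lra.
Qed.

Lemma Im_hdotE x y :
  complex.Im (hdot H x y) = complex.Re (hdot H x ('i%C *: y)).
Proof. by rewrite hdotZr complex_ReM complex_Re_conj complex_Im_conj /= mul0r
  mulN1r opprK add0r. Qed.

Lemma sqrnormi x : sqrnorm ('i%C *: x) = sqrnorm x.
Proof. by rewrite sqrnormZ /sqrmod /= expr0n expr1n add0r mul1r. Qed.

Lemma Im_hdot_le x y : `|complex.Im (hdot H x y)| <= sqrnorm x + sqrnorm y.
Proof. by rewrite Im_hdotE (le_trans (Re_hdot_le _ _))// sqrnormi. Qed.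

Lemma sqr_hnorm x : hnorm x ^+ 2 = sqrnorm x.
Proof. by rewrite sqr_sqrtr // sqrnorm_ge0. Qed.

Lemma hnorm_ge0 x : 0 <= hnorm x.
Proof. exact: sqrtr_ge0. Qed.

Lemma Re_hdot_CauchySchwarz x y : complex.Re (hdot H x y) <= hnorm x * hnorm y.
Proof.
have [/eqP|nx] := eqVneq (sqrnorm x) 0.
  rewrite sqrnorm_eq0 => /eqP ->; rewrite hdot0l.
  by rewrite mulr_ge0 ?hnorm_ge0.
have x0 : 0 < sqrnorm x by rewrite lt_neqAle eq_sym nx sqrnorm_ge0.
apply: le_trans (ler_norm _) _.
rewrite -(@ler_pXn2r _ 2) ?nnegrE ?mulr_ge0 ?hnorm_ge0// -normrX ger0_norm
  ?sqr_ge0//.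
rewrite exprMn !sqr_hnorm.
set r := complex.Re _.
(* Among the real multiples of [x], this one minimizes the norm of the sum with [y]. *)
have := sqrnorm_ge0 (((- (r / sqrnorm x))%:C)%C *: x + y).
rewrite sqrnormD sqrnormZ hdotZl complex_ReM /= mul0r subr0 -/r /sqrmod /=
  expr0n addr0.
rewrite sqrrN expr_div_n.
have -> : r ^+ 2 / sqrnorm x ^+ 2 * sqrnorm x + sqrnorm y +
  2 * (- (r / sqrnorm x) * r) = sqrnorm y - r ^+ 2 / sqrnorm x by field.
by rewrite subr_ge0 ler_pdivrMr// mulrC.
Qed.

Lemma hnormD x y : hnorm (x + y) <= hnorm x + hnorm y.
Proof.
rewrite -(@ler_pXn2r _ 2) ?nnegrE ?addr_ge0 ?hnorm_ge0//.
rewrite sqr_hnorm sqrnormD sqrrD !sqr_hnorm.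
have := Re_hdot_CauchySchwarz x y; lra.
Qed.

Lemma hnormN x : hnorm (- x) = hnorm x.
Proof. by rewrite /hnorm /dot_norm -!/(sqrnorm _) sqrnormN. Qed.

Lemma ler_hnorm x y : (hnorm x <= hnorm y) = (sqrnorm x <= sqrnorm y).
Proof. by rewrite -(@ler_pXn2r _ 2) ?nnegrE ?hnorm_ge0// !sqr_hnorm. Qed.

End HilbertBasics.

(** Polarization: the norm of x + y recovers the real part of the inner product, and replacing y by
    i y recovers the imaginary part. *)
Lemma isometry_sqrnorm (R : realType) (H K : hilbertType R)
    (V : {linear H -> K}) :
  (forall x, sqrnorm (V x) = sqrnorm x) -> isometry (hdot K) (hdot H) V.
Proof.
move=> nV.
have re x y : complex.Re (hdot K (V x) (V y)) = complex.Re (hdot H x y).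
  have := nV (x + y); rewrite linearD !sqrnormD !nV; lra.
move=> x y; apply: complex_ext; first exact: re.
by rewrite !Im_hdotE -re [in RHS]linearZZ.
Qed.

(** The inverse is the adjoint: <U x, y> = <U x, U W y> = <x, W y>. *)
Lemma unitary_isometry_bij (R : realType) (H : hilbertType R)
    (U W : {linear H -> H}) :
  (forall x, sqrnorm (U x) = sqrnorm x) -> cancel W U -> cancel U W ->
  unitary_op U.
Proof.
move=> nU WK UK; exists W; split => // x y.
by rewrite -{1}(WK y) (isometry_sqrnorm nU).
Qed.

(** * Sums over the integers *)

Section IntSums.
Variable R : realType.
Implicit Types u v : int -> R.

(* Sums over Z are limits of the sums over -N <= n < N. *)
Definition psum u (N : nat) : R := \sum_(k < N) (u (Posz k) + u (Negz k)).

Definition abs_summable u : Prop :=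
  exists M, forall N, psum (fun n => `|u n|) N <= M.

Definition rsum u : R := lim (psum u @ \oo).

Lemma psumS u N : psum u N.+1 = psum u N + (u (Posz N) + u (Negz N)).
Proof. by rewrite /psum big_ord_recr. Qed.

Lemma psum0 u : psum u 0 = 0.
Proof. by rewrite /psum big_ord0. Qed.

Lemma psumD u v N : psum (fun n => u n + v n) N = psum u N + psum v N.
Proof. by rewrite /psum -big_split/=; apply: eq_bigr => k _; ring. Qed.

Lemma psumZ c u N : psum (fun n => c * u n) N = c * psum u N.
Proof. by rewrite /psum mulr_sumr; apply: eq_bigr => k _; ring. Qed.

Lemma ler_psum u v N : (forall n, u n <= v n) -> psum u N <= psum v N.
Proof. by move=> uv; apply: ler_sum => k _; exact: lerD. Qed.

Lemma abs_summable_le u v :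
  (forall n, `|u n| <= v n) -> abs_summable v -> abs_summable u.
Proof.
move=> uv [M vM]; exists M => N; apply: le_trans (vM N); apply: ler_psum => n.
by rewrite (le_trans (uv n))// ler_norm.
Qed.

Lemma abs_summableD u v : abs_summable u -> abs_summable v ->
  abs_summable (fun n => u n + v n).
Proof.
move=> [M uM] [M' vM']; exists (M + M') => N.
apply: le_trans (lerD (uM N) (vM' N)).
by rewrite -psumD; apply: ler_psum => n; exact: ler_normD.
Qed.

Lemma abs_summableZ c u : abs_summable u -> abs_summable (fun n => c * u n).
Proof.
move=> [M uM]; exists (`|c| * M) => N.
under [X in psum X]funext do rewrite normrM.
by rewrite psumZ ler_wpM2l.
Qed.

(** Pairing the indices k and -k-1 turns [psum u] into the partial sums of an ordinary absolutely
    convergent series. *)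
Lemma abs_summable_cvg u : abs_summable u -> psum u N @[N --> \oo] --> rsum u.
Proof.
move=> [M uM].
rewrite /rsum; have -> : psum u = series (fun k => u (Posz k) + u (Negz k)).
  by apply/funext => N; rewrite /psum /series/= big_mkord.
apply: normed_cvg; apply: nondecreasing_is_cvgn.
  by apply: nondecreasing_series => n _ _; exact: normr_ge0.
exists M => _ [N _ <-]; apply: le_trans (uM N).
rewrite [leLHS](_ : _ = \sum_(k < N) `|u (Posz k) + u (Negz k)|); last first.
  by rewrite -(big_mkord xpredT (fun k => `|u (Posz k) + u (Negz k)|)).
apply: ler_sum => k _; exact: ler_normD.
Qed.

Lemma rsum_unique u l : psum u N @[N --> \oo] --> l -> rsum u = l.
Proof. by move=> ul; apply/cvg_lim. Qed.

Lemma rsumD u v : abs_summable u -> abs_summable v ->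
  rsum (fun n => u n + v n) = rsum u + rsum v.
Proof.
move=> su sv; apply: rsum_unique; under eq_fun do rewrite psumD.
by apply: cvgD; exact: abs_summable_cvg.
Qed.

Lemma rsumZ c u : abs_summable u -> rsum (fun n => c * u n) = c * rsum u.
Proof.
move=> su; apply: rsum_unique; under eq_fun do rewrite psumZ.
by apply: cvgM; [exact: cvg_cst | exact: abs_summable_cvg].
Qed.

Lemma psum_le_bound u M N : (forall n, 0 <= u n) ->
  (forall N, psum u N <= M) -> psum u N <= rsum u <= M.
Proof.
move=> u0 uM.
have cu : psum u N @[N --> \oo] --> rsum u.
  apply: abs_summable_cvg; exists M => K.
  by under [X in psum X]funext do rewrite ger0_norm//.
apply/andP; split; last by apply: (cvgr_to_le cu); exact: nearW.
apply: (@nondecreasing_cvgn_le _ (psum u)) => //.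
by apply/nondecreasing_seqP => n; rewrite psumS lerDl addr_ge0.
Qed.

Lemma psum_le_rsum u N :
  (forall n, 0 <= u n) -> abs_summable u -> psum u N <= rsum u.
Proof.
move=> u0 [M]; under [X in psum X]funext do rewrite ger0_norm//.
by move=> uM; have /andP[] := psum_le_bound N u0 uM.
Qed.

Lemma rsum_le u M :
  (forall n, 0 <= u n) -> (forall N, psum u N <= M) -> rsum u <= M.
Proof. by move=> u0 uM; have /andP[] := psum_le_bound 0 u0 uM. Qed.

Lemma rsum_ge0 u : (forall n, 0 <= u n) -> abs_summable u -> 0 <= rsum u.
Proof. by move=> u0 su; rewrite -(psum0 u) psum_le_rsum. Qed.

Lemma le_rsum u n : (forall n, 0 <= u n) -> abs_summable u -> u n <= rsum u.
Proof.
move=> u0 su.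
have p0 N : 0 <= psum u N by rewrite sumr_ge0// => k _; rewrite addr_ge0.
apply: le_trans (psum_le_rsum (absz n).+1 u0 su); rewrite psumS.
have : 0 <= psum u (absz n) by [].
case: n => n /=.
  have := u0 (Negz n); lra.
move=> _; have : u (Negz n) <= psum u n.+1.
  by rewrite psumS; have := p0 n; have := u0 n; lra.
have := u0 n.+1; have := u0 (Negz n.+1); lra.
Qed.

Lemma abs_summable_cvg0 u : abs_summable u ->
  (u (Posz N) @[N --> \oo] --> 0) /\ (u (Negz N) @[N --> \oo] --> 0).
Proof.
move=> [M uM].
pose v n := `|u n|.
have cv : psum v N @[N --> \oo] --> rsum v.
  apply: abs_summable_cvg; exists M => N.
  by under [X in psum X]funext do rewrite normr_id.
have c0 : (`|u (Posz N)| + `|u (Negz N)|) @[N --> \oo] --> 0.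
  have -> : (fun N => `|u (Posz N)| + `|u (Negz N)|) =
            (fun N => psum v N.+1 - psum v N).
    by apply/funext => N; rewrite psumS [RHS]addrAC subrr add0r.
  by rewrite -(subrr (rsum v)); apply: cvgB => //;
    rewrite (cvg_shiftS (psum v)).
split; apply/norm_cvg0P; apply: squeeze_cvgr c0; try exact: cvg_cst;
  by near=> N; rewrite normr_ge0/= ?lerDl ?lerDr.
Unshelve. all: by end_near. Qed.

(** The reflection n -> -n-1, which preserves each window -N <= n < N and conjugates the successor
    into the predecessor. *)
Definition int_rev (n : int) : int :=
  match n with Posz k => Negz k | Negz k => Posz k end.

Lemma int_revE n : int_rev n = - n - 1.
Proof. by case: n => n /=; lia. Qed.

Lemma psum_rev u N : psum (fun n => u (int_rev n)) N = psum u N.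
Proof. by apply: eq_bigr => k _; rewrite addrC. Qed.

(** The shifted window gains the index N + 1 and loses -(N + 1); starting from [N.+1] keeps the lost
    index inside the window. *)
Lemma psum_succ u N : psum (fun n => u (n + 1)) N.+1 =
  psum u N.+1 + u (Posz N.+1) - u (Negz N).
Proof.
elim: N => [|N IH].
  rewrite !psumS !psum0 (_ : Negz 0 + 1 = Posz 0)//; ring.
rewrite psumS IH [in RHS]psumS.
rewrite (_ : Negz N.+1 + 1 = Negz N)//; last lia.
rewrite (_ : Posz N.+1 + 1 = Posz N.+2)//; [ring | lia].
Qed.

(** The two boundary terms of the shifted window tend to 0 by summability. *)
Lemma rsum_succ u : abs_summable u -> rsum (fun n => u (n + 1)) = rsum u.
Proof.
move=> su; apply: rsum_unique; have [u1 u2] := abs_summable_cvg0 su.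
have su' := abs_summable_cvg su.
rewrite -(cvg_shiftS (psum (fun n => u (n + 1)))) /=.
under eq_fun do rewrite psum_succ.
rewrite (_ : rsum u = rsum u + 0 - 0); last by rewrite subr0 addr0.
apply: cvgB => //; apply: cvgD; first by rewrite (cvg_shiftS (psum u)).
by rewrite (cvg_shiftS (fun N => u (Posz N))).
Qed.

Lemma abs_summable_succ u : abs_summable u -> abs_summable (fun n => u (n + 1)).
Proof.
move=> [M uM]; exists M => N; apply: le_trans (uM N.+1).
case: N => [|N].
  by rewrite psum0 sumr_ge0// => k _; rewrite addr_ge0.
rewrite (psum_succ (fun n => `|u n|)) [in leRHS]psumS.
by have := normr_ge0 (u (Negz N)); have := normr_ge0 (u (Negz N.+1)); lra.
Qed.

Lemma abs_summable_rev u : abs_summable u ->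
  abs_summable (fun n => u (int_rev n)).
Proof.
by move=> [M uM]; exists M => N; rewrite (psum_rev (fun n => `|u n|)).
Qed.

Lemma int_rev_pred n : int_rev (int_rev n + 1) = n - 1.
Proof. rewrite !int_revE; lia. Qed.

Lemma abs_summable_pred u : abs_summable u -> abs_summable (fun n => u (n - 1)).
Proof.
move=> /abs_summable_rev/abs_summable_succ/abs_summable_rev.
by under [X in abs_summable X -> _]funext do rewrite int_rev_pred.
Qed.

End IntSums.

(** * The Hilbert space of square-summable sequences over the integers *)

Section ComplexSums.
Variable R : realType.
Implicit Types u v : int -> R[i].

Definition csummable u : Prop :=
  abs_summable (fun n => complex.Re (u n)) /\
  abs_summable (fun n => complex.Im (u n)).

Definition csum u : R[i] :=
  Complex (rsum (fun n => complex.Re (u n))) (rsum (fun n => complex.Im (u n))).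

Lemma csumD u v : csummable u -> csummable v ->
  csum (fun n => u n + v n) = csum u + csum v.
Proof.
move=> [su su'] [sv sv']; apply: complex_ext;
  rewrite ?complex_ReD ?complex_ImD /= -rsumD//.
  by congr rsum; apply/funext => n; rewrite complex_ReD.
by congr rsum; apply/funext => n; rewrite complex_ImD.
Qed.

Lemma csumZ c u : csummable u -> csum (fun n => c * u n) = c * csum u.
Proof.
move=> [su su']; apply: complex_ext;
  rewrite ?complex_ReM ?complex_ImM /= -?mulNr -!rsumZ//;
  rewrite -rsumD; try exact: abs_summableZ.
  by congr rsum; apply/funext => n; rewrite complex_ReM mulNr.
by congr rsum; apply/funext => n; rewrite complex_ImM.
Qed.

Lemma csum_succ u : csummable u -> csum (fun n => u (n + 1)) = csum u.
Proof. by move=> [/rsum_succ su /rsum_succ su']; congr Complex. Qed.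

Lemma csum_conj u : csummable u -> csum (fun n => (u n)^*) = (csum u)^*.
Proof.
move=> [su su']; apply: complex_ext;
  rewrite ?complex_Re_conj ?complex_Im_conj /=.
  by congr rsum; apply/funext => n; rewrite complex_Re_conj.
rewrite -mulN1r -rsumZ//; congr rsum; apply/funext => n.
by rewrite complex_Im_conj mulN1r.
Qed.

End ComplexSums.

Section SquareSummable.
Variables (R : realType) (E : hilbertType R).

Definition square_summable : {pred int -> E} :=
  fun f => `[< abs_summable (fun n => sqrnorm (f n)) >].

Lemma square_summable_submod : submod_closed square_summable.
Proof.
split=> [|c f g /asboolP sf /asboolP sg].
  apply/asboolP; exists 0 => N; rewrite /psum big1 // => k _.
  by rewrite sqrnorm0 normr0 addr0.
(* The crude bound on the cross term contributes twice the sum of the two squares, whence the factor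
   3. *)
apply/asboolP; apply: (@abs_summable_le _ _ (fun n =>
    3 * sqrmod c * sqrnorm (f n) + 3 * sqrnorm (g n))) => [n|]; last first.
  by apply: abs_summableD; exact: abs_summableZ.
rewrite ger0_norm ?sqrnorm_ge0// -[(_ + _) n]/(c *: f n + g n).
rewrite sqrnormD sqrnormZ.
have := Re_hdot_le (c *: f n) (g n); rewrite sqrnormZ ler_norml => /andP[_].
lra.
Qed.

HB.instance Definition _ := GRing.isSubmodClosed.Build R[i] (int -> E)
  square_summable square_summable_submod.

Record l2_space := L2Space { l2_fun :> int -> E;
  _ : l2_fun \in square_summable }.

HB.instance Definition _ := [isSub for l2_fun].
HB.instance Definition _ := [Choice of l2_space by <:].
HB.instance Definition _ := [SubChoice_isSubLmodule of l2_space by <:].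

Implicit Types f g : l2_space.

Lemma l2_summable f : abs_summable (fun n => sqrnorm (f n)).
Proof. by case: f => f /= /asboolP. Qed.

Lemma l2_ext f g : (forall n, f n = g n) -> f = g.
Proof. by move=> fg; apply/val_inj/funext. Qed.

Lemma l2D f g n : (f + g) n = f n + g n.
Proof. by []. Qed.

Lemma l2Z c f n : (c *: f) n = c *: f n.
Proof. by []. Qed.

Lemma l2N f n : (- f) n = - f n.
Proof. by []. Qed.

Lemma l2_csummable f g : csummable (fun n => hdot E (f n) (g n)).
Proof.
split; apply: (@abs_summable_le _ _ (fun n => sqrnorm (f n) + sqrnorm (g n)))
  => [n|]; try (by apply: abs_summableD; exact: l2_summable).
- exact: Re_hdot_le.
- exact: Im_hdot_le.
Qed.

Definition l2_dot f g : R[i] := csum (fun n => hdot E (f n) (g n)).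

Lemma l2_dotC f g : l2_dot g f = (l2_dot f g)^*.
Proof.
rewrite /l2_dot -csum_conj; last exact: l2_csummable.
by congr csum; apply/funext => n; rewrite hdotC.
Qed.

Lemma l2_dotPl g c f f' :
  l2_dot (c *: f + f') g = c * l2_dot f g + l2_dot f' g.
Proof.
rewrite /l2_dot -csumZ; last exact: l2_csummable.
have sf := l2_csummable f g; have sf' := l2_csummable f' g.
have scf := l2_csummable (c *: f) g.
have scfE : (fun n => hdot E ((c *: f) n) (g n)) =
  (fun n => c * hdot E (f n) (g n)).
  by apply/funext => n; rewrite l2Z hdotZl.
rewrite scfE in scf.
by rewrite -csumD//; congr csum; apply/funext => n;
  rewrite l2D l2Z hdotDl hdotZl.
Qed.

Lemma l2_dotPr f c g g' :
  l2_dot f (c *: g + g') = c^* * l2_dot f g + l2_dot f g'.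
Proof.
by rewrite l2_dotC l2_dotPl rmorphD rmorphM /= -!l2_dotC.
Qed.

Fact l2_dot_bilinear : bilinear_for
  (GRing.Scale.Law.clone _ _ *%R _) (GRing.Scale.Law.clone _ _ (conjC \; *%R) _)
  l2_dot.
Proof. by split=> [g|f] a x y; [exact: l2_dotPl|exact: l2_dotPr]. Qed.

HB.instance Definition _ := bilinear_isBilinear.Build R[i] l2_space l2_space
  R[i]
  _ _ l2_dot l2_dot_bilinear.

Fact l2_dot_hermitian f g : l2_dot f g = (-1) ^+ false * (l2_dot g f)^*.
Proof. by rewrite expr0 mul1r l2_dotC. Qed.

HB.instance Definition _ := isHermitianSesquilinear.Build R[i] l2_space false
  conjC
  l2_dot l2_dot_hermitian.

Lemma l2_dotE f : l2_dot f f = (rsum (fun n => sqrnorm (f n)))%:C%C.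
Proof.
apply: complex_ext => //=; apply: rsum_unique.
have -> : psum (fun n => complex.Im (hdot E (f n) (f n))) = fun=> 0.
  by apply/funext => N; rewrite /psum big1 // => k _; rewrite !hdotE /= addr0.
exact: cvg_cst.
Qed.

Fact l2_dot_gt0 f : f != 0 -> 0 < l2_dot f f.
Proof.
move=> f0; rewrite l2_dotE ltcR.
have [n fn0] : exists n, f n != 0.
  apply: contrapT => /forallNP fn; move/eqP : f0; apply; apply: l2_ext => n.
  by apply/eqP; move/negP : (fn n); rewrite negbK.
apply: lt_le_trans (le_rsum n _ (l2_summable f)).
  by rewrite lt_neqAle eq_sym sqrnorm_eq0 fn0 sqrnorm_ge0.
by move=> k; exact: sqrnorm_ge0.
Qed.

HB.instance Definition _ := isDotProduct.Build R[i] l2_space l2_dot l2_dot_gt0.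

Lemma l2_normE f : dot_norm l2_dot f = Num.sqrt (rsum (fun n => sqrnorm (f n))).
Proof. by rewrite /dot_norm -[X in complex.Re X]/(l2_dot f f) l2_dotE. Qed.

Lemma l2_coord_le f n : hnorm (f n) <= dot_norm l2_dot f.
Proof.
rewrite l2_normE ler_wsqrtr//; apply: (le_rsum n _ (l2_summable f)) => k.
exact: sqrnorm_ge0.
Qed.

Lemma psum_cvg (u : nat -> int -> R) v N :
  (forall n, u k n @[k --> \oo] --> v n) -> psum (u k) N @[k --> \oo] -->
    psum v N.
Proof.
move=> uv; elim: N => [|N IH].
  by under eq_fun do rewrite psum0; rewrite psum0; exact: cvg_cst.
under eq_fun do rewrite psumS; rewrite psumS.
by apply: cvgD => //; apply: cvgD.
Qed.

(** The candidate limit is taken coordinatewise; a bound on finite windows, uniform in the window,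
    then gives convergence in norm. *)
Lemma l2_complete : dot_complete l2_dot.
Proof.
move=> u uC.
have /choice[l lP] : forall n, exists l :
  E, hnorm (u k n - l) @[k --> \oo] --> (0 : R).
  move=> n; apply: (hilbert_complete (h := E) (u := fun k => u k n)) => e e0.
  have := uC e e0; apply: filterS => -[p q] /=; apply: le_lt_trans.
  exact: (l2_coord_le (u p - u q) n).
(* Fatou: the bound on [u p - u q] passes to the limit in [q]. *)
have bnd e : 0 < e -> \forall p \near \oo, forall N,
    psum (fun n => sqrnorm (u p n - l n)) N <= e ^+ 2.
  move=> e0.
  have [[A B] /= [[a _ Aa] [b _ Bb]] AB] := uC e e0.
  exists a => // p ap N.
  have cv : psum (fun n => sqrnorm (u p n - u q n)) N @[q --> \oo] -->
      psum (fun n => sqrnorm (u p n - l n)) N.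
    apply: psum_cvg => n.
    rewrite -sqr_hnorm; under eq_fun do rewrite -sqr_hnorm.
    rewrite expr2; under eq_fun do rewrite expr2.
    suff h : hnorm (u p n - u q n) @[q --> \oo] --> hnorm (u p n - l n).
      exact: cvgM.
    (* By the triangle inequality both ways, the norm of [u p n - u q n] differs from [r] by at most
       that of [u q n - l n], which tends to 0. *)
    pose r := hnorm (u p n - l n).
    have h0 : (r - hnorm (u q n - l n)) @[q --> \oo] --> r - 0.
      by apply: cvgB; [exact: cvg_cst|exact: lP].
    have h1 : (r + hnorm (u q n - l n)) @[q --> \oo] --> r + 0.
      by apply: cvgD; [exact: cvg_cst|exact: lP].
    rewrite subr0 in h0; rewrite addr0 in h1.
    apply: squeeze_cvgr h0 h1; near=> q; apply/andP; split.
      rewrite lerBlDr; have := hnormD (u p n - u q n) (u q n - l n).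
      by rewrite addrA subrK.
    have := hnormD (u p n - l n) (- (u q n - l n)).
    by rewrite hnormN opprB addrA subrK.
  apply: (cvgr_to_le cv); exists b => // q bq.
  have := AB (p, q) (conj (Aa _ ap) (Bb _ bq)) => /= /ltW.
  rewrite -(@ler_pXn2r _ 2) ?nnegrE ?sqrtr_ge0 ?(ltW e0)//.
  rewrite l2_normE sqr_sqrtr; last first.
    by apply: rsum_ge0; [move=> k; exact: sqrnorm_ge0|exact: l2_summable].
  apply: le_trans.
  by apply: psum_le_rsum; [move=> k;
    exact: sqrnorm_ge0|exact: (l2_summable (u p - u q))].
(* Square-summability of [l] is obtained indirectly: [u p - l] is square-summable for a single [p],
   and [l] is [u p] minus this difference. *)
have [p hp] : exists p, forall N, psum (fun n => sqrnorm (u p n - l n)) N <= 1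
  ^+ 2.
  by have [a _ h] := bnd 1 ltr01; exists a; apply: h => /=.
have lin : (fun n => u p n - l n) \in square_summable.
  apply/asboolP; exists (1 ^+ 2) => N.
  by under [X in psum X]funext do rewrite ger0_norm ?sqrnorm_ge0//.
pose g := u p - L2Space lin.
have gE n : g n = l n by rewrite l2D l2N /= opprB addrC subrK.
exists g; apply/cvgr0Pnorm_le => e e0.
have := bnd e e0; apply: filterS => q hq.
rewrite ger0_norm ?sqrtr_ge0// l2_normE -[leRHS](ger0_norm (ltW e0)) -sqrtr_sqr.
rewrite ler_wsqrtr// rsum_le// => [k|N]; first exact: sqrnorm_ge0.
by under [X in psum X]funext do rewrite l2D l2N gE.
Unshelve. all: by end_near. Qed.

End SquareSummable.

Definition l2 (R : realType) (E : hilbertType R) : hilbertType R :=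
  HilbertType (@l2_complete R E).

(** * Unitary operators with symbol X + z Y *)

Section Adjoints.
Variables (R : realType) (H K L : hilbertType R).

Lemma is_adjoint_sym (T : {linear H -> K}) (S : {linear K -> H}) :
  is_adjoint T S -> is_adjoint S T.
Proof. by move=> TS x y; rewrite hdotC -TS -hdotC. Qed.

Lemma is_adjoint_comp (T : {linear H -> K}) Ts (S : {linear K -> L}) Ss :
  is_adjoint T Ts -> is_adjoint S Ss ->
  is_adjoint (S \o T : {linear H -> L}) (Ts \o Ss : {linear L -> H}).
Proof. by move=> TTs SSs x y /=; rewrite SSs TTs. Qed.

Lemma is_adjoint_add (T S : {linear H -> K}) Ts Ss :
  is_adjoint T Ts -> is_adjoint S Ss ->
  is_adjoint (T \+ S : {linear H -> K}) (Ts \+ Ss : {linear K -> H}).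
Proof. by move=> TTs SSs x y /=; rewrite hdotDl hdotDr TTs SSs. Qed.

End Adjoints.

Section Pencil.
Variables (R : realType) (E : hilbertType R).

(* The coefficients of an operator function X + z Y, with adjoints, that is
   unitary for every z on the unit circle. *)
Record pencil := Pencil {
  pX : {linear E -> E}; pY : {linear E -> E};
  pXs : {linear E -> E}; pYs : {linear E -> E};
  pX_adj : is_adjoint pX pXs;
  pY_adj : is_adjoint pY pYs;
  pencil_l1 : forall x, pXs (pX x) + pYs (pY x) = x;
  pencil_l2 : forall x, pXs (pY x) = 0;
  pencil_l3 : forall x, pYs (pX x) = 0;
  pencil_r1 : forall x, pX (pXs x) + pY (pYs x) = x;
  pencil_r2 : forall x, pX (pYs x) = 0;
  pencil_r3 : forall x, pY (pXs x) = 0 }.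

Definition contractive (X : {linear E -> E}) :=
  forall x, sqrnorm (X x) <= sqrnorm x.

(** The hypothesis amounts to |X x|^2 + |Y x|^2 = |x|^2. *)
Lemma contractive_sum (X Y Xs Ys : {linear E -> E}) :
  is_adjoint X Xs -> is_adjoint Y Ys -> (forall x, Xs (X x) + Ys (Y x) = x) ->
  contractive X /\ contractive Y.
Proof.
move=> aX aY XY.
have s x : sqrnorm (X x) + sqrnorm (Y x) = sqrnorm x.
  by rewrite /sqrnorm aX aY -complex_ReD -hdotDr XY.
by split=> x; rewrite -(s x) ?lerDl ?lerDr sqrnorm_ge0.
Qed.

Lemma pX_contractive p : contractive (pX p).
Proof. exact: (contractive_sum (pX_adj p) (pY_adj p) (pencil_l1 p)).1. Qed.

Lemma pY_contractive p : contractive (pY p).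
Proof. exact: (contractive_sum (pX_adj p) (pY_adj p) (pencil_l1 p)).2. Qed.

Lemma pXs_contractive p : contractive (pXs p).
Proof.
exact: (contractive_sum (is_adjoint_sym (pX_adj p)) (is_adjoint_sym (pY_adj p))
  (pencil_r1 p)).1.
Qed.

Lemma pYs_contractive p : contractive (pYs p).
Proof.
exact: (contractive_sum (is_adjoint_sym (pX_adj p)) (is_adjoint_sym (pY_adj p))
  (pencil_r1 p)).2.
Qed.

Section Lift.
Variables (X : {linear E -> E}) (cX : contractive X).

Fact lift_subproof (f : l2_space E) :
  (fun n => X (f n)) \in @square_summable R E.
Proof.
apply/asboolP; apply: abs_summable_le (l2_summable f) => n.
by rewrite ger0_norm ?sqrnorm_ge0.
Qed.

Definition l2_lift (f : l2_space E) : l2_space E := L2Space (lift_subproof f).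

Fact l2_lift_linear : linear l2_lift.
Proof. by move=> c f g; apply: l2_ext => n; rewrite /= linearP. Qed.

HB.instance Definition _ := GRing.isLinear.Build R[i] (l2_space E) (l2_space E)
  _ l2_lift l2_lift_linear.

End Lift.

Lemma l2_lift_adj X Xs (cX : contractive X) (cXs : contractive Xs) :
  is_adjoint X Xs ->
  is_adjoint (l2_lift cX : {linear l2 E -> l2 E}) (l2_lift cXs :
    {linear l2 E -> l2 E}).
Proof.
by move=> aX f g; congr csum; apply/funext => n; exact: aX.
Qed.

Fact shift_subproof (f : l2_space E) :
  (fun n => f (n - 1)) \in @square_summable R E.
Proof. by apply/asboolP; have /abs_summable_pred := l2_summable f. Qed.

Definition l2_shift (f : l2_space E) : l2_space E := L2Space (shift_subproof f).

Fact l2_shift_linear : linear l2_shift.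
Proof. by move=> c f g; apply: l2_ext. Qed.

HB.instance Definition _ := GRing.isLinear.Build R[i] (l2_space E) (l2_space E)
  _ l2_shift l2_shift_linear.

Fact unshift_subproof (f : l2_space E) :
  (fun n => f (n + 1)) \in @square_summable R E.
Proof. by apply/asboolP; have /abs_summable_succ := l2_summable f. Qed.

Definition l2_unshift (f : l2_space E) :
  l2_space E := L2Space (unshift_subproof f).

Fact l2_unshift_linear : linear l2_unshift.
Proof. by move=> c f g; apply: l2_ext. Qed.

HB.instance Definition _ := GRing.isLinear.Build R[i] (l2_space E) (l2_space E)
  _ l2_unshift l2_unshift_linear.

Lemma l2_shift_adj :
  is_adjoint (l2_shift : {linear l2 E -> l2 E}) (l2_unshift :
    {linear l2 E -> l2 E}).
Proof.
move=> f g; rewrite -[LHS]csum_succ; last exact: l2_csummable.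
by congr csum; apply/funext => n; rewrite /= addrK.
Qed.

(** The sign (-1)^n when [e] is true and 1 otherwise: one construction then covers both plain and
    alternating multiplication operators. *)
Definition alt (e : bool) (n : int) : R[i] := (-1) ^+ (e && odd (absz n)).

Lemma altS e n : alt e (n + 1) = (-1) ^+ e * alt e n.
Proof.
rewrite /alt (_ : odd (absz (n + 1)) = ~~ odd (absz n)); last lia.
by rewrite -signr_addb; case: e; case: odd.
Qed.

Lemma altP e n : alt e (n - 1) = (-1) ^+ e * alt e n.
Proof.
rewrite -{2}(subrK 1 n) altS mulrA -expr2 sqrr_sign mul1r //.
Qed.

Lemma altK e n x : alt e n *: (alt e n *: x) = x :> E.
Proof. by rewrite scalerA -expr2 sqrr_sign scale1r. Qed.

Lemma alt_signK (e : bool) n :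
  (-1) ^+ e * alt e n * (-1) ^+ e * alt e n = 1.
Proof. by rewrite /alt -mulrA mulrACA -!expr2 !sqrr_sign mulr1. Qed.

Lemma alt_conj e n : (alt e n)^* = alt e n.
Proof. by rewrite rmorph_sign. Qed.

Fact alternate_subproof e (f : l2_space E) :
  (fun n => alt e n *: f n) \in @square_summable R E.
Proof.
apply/asboolP; apply: abs_summable_le (l2_summable f) => n.
rewrite ger0_norm ?sqrnorm_ge0// sqrnormZ /alt.
by case: (_ && _); rewrite ?expr1 /sqrmod /= ?oppr0 ?sqrrN expr1n expr0n addr0
  mul1r.
Qed.

Definition l2_alternate e (f : l2_space E) : l2_space E :=
  L2Space (alternate_subproof e f).

Fact l2_alternate_linear e : linear (l2_alternate e).
Proof.
move=> c f g; apply: l2_ext => n.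
by rewrite -[LHS]/(alt e n *: (c *: f n + g n)) scalerDr !scalerA mulrC
  -scalerA.
Qed.

HB.instance Definition _ e := GRing.isLinear.Build R[i] (l2_space E) (l2_space
  E)
  _ (l2_alternate e) (l2_alternate_linear e).

Lemma l2_alternate_adj e : is_adjoint (l2_alternate e : {linear l2 E -> l2 E})
  (l2_alternate e : {linear l2 E -> l2 E}).
Proof.
move=> f g; congr csum; apply/funext => n /=.
by rewrite hdotZl hdotZr alt_conj.
Qed.

(** With sequences read as Fourier coefficients, [l2_shift] is multiplication by z, and this is
    multiplication by X + z Y followed by the sign in degree n. *)
Definition pencil_op e p : {linear l2 E -> l2 E} :=
  l2_alternate e \o (l2_lift (pX_contractive p) \+
                     (l2_lift (pY_contractive p) \o l2_shift)).

Definition pencil_op_adj e p : {linear l2 E -> l2 E} :=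
  (l2_lift (pXs_contractive p) \+ (l2_unshift \o l2_lift (pYs_contractive p)))
  \o l2_alternate e.

Lemma pencil_opE e p (f : l2_space E) n :
  (pencil_op e p f : l2_space E) n = alt e n *: (pX p (f n) + pY p (f (n - 1))).
Proof. by []. Qed.

Lemma pencil_op_adjE e p (f : l2_space E) n :
  (pencil_op_adj e p f : l2_space E) n =
  alt e n *: (pXs p (f n) + (-1) ^+ e *: pYs p (f (n + 1))).
Proof.
rewrite -[LHS]/(pXs p (alt e n *: f n) + pYs p (alt e (n + 1) *: f (n + 1))).
by rewrite !linearZ /= altS scalerDr scalerA mulrC.
Qed.

Lemma pencil_op_is_adjoint e p : is_adjoint (pencil_op e p) (pencil_op_adj e p).
Proof.
apply: is_adjoint_comp (l2_alternate_adj e); apply: is_adjoint_add.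
  exact: l2_lift_adj (pX_adj p).
apply: is_adjoint_comp l2_shift_adj _; exact: l2_lift_adj (pY_adj p).
Qed.

(** The mixed relations of the pencil cancel the terms from the neighbouring degrees, the signs
    square to 1, and the identity remains in degree n. *)
Lemma pencil_op_unitary e p : unitary_op (pencil_op e p).
Proof.
exists (pencil_op_adj e p); split; first exact: pencil_op_is_adjoint.
- move=> f; apply: (@l2_ext _ E) => n;
    rewrite pencil_opE !pencil_op_adjE subrK altP.
  rewrite !linearZ /= !linearD /= !linearZ /= pencil_r2 pencil_r3 !scaler0
    addr0 add0r.
  by rewrite altK !scalerA alt_signK scale1r pencil_r1.
- move=> f; apply: (@l2_ext _ E) => n;
    rewrite pencil_op_adjE !pencil_opE addrK altS.
  rewrite !linearZ /= !linearD /= pencil_l2 pencil_l3 !scaler0 addr0 add0r.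
  by rewrite altK !scalerA [alt e n * _]mulrC alt_signK scale1r pencil_l1.
Qed.

End Pencil.

(** * Co-extensions and the shift model *)

Section Compressions.
Variables (R : realType) (H K : hilbertType R).

(** Matrix coefficients replace the adjoint of [V], so that dilations compose without constructing
    adjoints; on C^n the adjoint is supplied afterwards by [Cn_adjoint]. *)
Definition weak_dilates (k : nat) (N : k.-tuple {linear K -> K})
    (T : k.-tuple {linear H -> H}) : Prop :=
  exists V : {linear H -> K}, isometry (hdot K) (hdot H) V /\
    forall m x y, hdot K (monomial_op N m (V x)) (V y) =
                  hdot H (monomial_op T m x) y.

Lemma monomial3E (T1 T2 T3 : {linear H -> H}) (m : 3.-tuple nat) x :
  monomial_op [tuple T1; T2; T3] m x =
  iter (tnth m ord0) T1 (iter (tnth m (lift ord0 ord0)) T2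
    (iter (tnth m (lift ord0 (lift ord0 ord0))) T3 x)).
Proof. by rewrite /monomial_op !big_ord_recl big_ord0. Qed.

(* [Ts] stands for the adjoint of the operator of which [N] is a dilation. *)
Definition coextends (V : H -> K) (P : K -> Prop) (N : K -> K) (Ts : H -> H) :=
  forall f, P f -> P (N f) /\ forall y, hdot K (N f) (V y) =
    hdot K f (V (Ts y)).

Lemma coextends_comp V P N Ts N' Ts' :
  coextends V P N Ts -> coextends V P N' Ts' ->
  coextends V P (N \o N') (Ts' \o Ts).
Proof.
move=> NT NT' f /NT'[Pf ff]; have [PNf Nf] := NT _ Pf.
by split => // y; rewrite /= Nf ff.
Qed.

Lemma coextends_iter V P N Ts n :
  coextends V P N Ts -> coextends V P (iter n N) (iter n Ts).
Proof.
move=> NT; elim: n => [|n IH]; first by split.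
rewrite (_ : iter n.+1 Ts = iter n Ts \o Ts); first exact: coextends_comp.
by apply/funext => y; rewrite iterSr.
Qed.

Lemma adjoint_iter (T Ts : {linear H -> H}) n x y : is_adjoint T Ts ->
  hdot H (iter n T x) y = hdot H x (iter n Ts y).
Proof.
move=> TTs; elim: n x y => [//|n IH] x y.
by rewrite iterS TTs IH -iterSr.
Qed.

(** The powers of [N1], [N2], [N3] are moved in turn to the right-hand side as powers of [S1], [S2],
    [S3]. The invariant predicate [P] allows the move for vectors that have already left the range
    of [V]. *)
Lemma coextends_weak_dilates (V : {linear H -> K}) P
    (N1 N2 N3 : {linear K -> K}) (T1 T2 T3 S1 S2 S3 : {linear H -> H}) :
  isometry (hdot K) (hdot H) V -> (forall x, P (V x)) ->
  is_adjoint T1 S1 -> is_adjoint T2 S2 -> is_adjoint T3 S3 ->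
  coextends V P N1 S1 -> coextends V P N2 S2 -> coextends V P N3 S3 ->
  weak_dilates [tuple N1; N2; N3] [tuple T1; T2; T3].
Proof.
move=> Viso PV a1 a2 a3 c1 c2 c3; exists V; split=> // m x y.
rewrite monomial3E.
set m1 := tnth m _; set m2 := tnth m _; set m3 := tnth m _.
rewrite /monomial_op !big_ord_recl big_ord0 /= -/m1 -/m2 -/m3.
have [P3 e3] := coextends_iter m3 c3 (PV x).
have [P2 e2] := coextends_iter m2 c2 P3.
have [P1 e1] := coextends_iter m1 c1 P2.
rewrite e1 e2 e3 (adjoint_iter _ _ _ a1) (adjoint_iter _ _ _ a2).
by rewrite (adjoint_iter _ _ _ a3); exact: Viso.
Qed.

End Compressions.

Lemma weak_dilates_trans (R : realType) (H K L : hilbertType R) k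
    (M : k.-tuple {linear L -> L}) (N : k.-tuple {linear K -> K})
    (T : k.-tuple {linear H -> H}) :
  weak_dilates M N -> weak_dilates N T -> weak_dilates M T.
Proof.
move=> [W [Wiso WM]] [V [Viso VN]]; exists (W \o V : {linear H -> L}).
by split=> [x y|m x y] /=; rewrite ?Wiso ?Viso ?WM ?VN.
Qed.

Lemma weak_dilates_refl (R : realType) (H : hilbertType R) k
    (T : k.-tuple {linear H -> H}) : weak_dilates T T.
Proof. by exists idfun; split. Qed.

(** * Adjoints of maps out of C^n *)

Section FiniteDimension.
Variables (R : realType) (n : nat) (K : hilbertType R) (V :
  {linear Cn R n -> K}).

(** The formula is forced: it is the adjoint identity tested on the basis vectors. *)
Definition Cn_adjoint (y : K) : Cn R n :=
  \row_j hdot K y (V (delta_mx 0 j : 'rV[R[i]]_n)).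

Fact Cn_adjoint_linear : linear Cn_adjoint.
Proof. by move=> c x y; apply/rowP => j; rewrite !mxE hdotDl hdotZl. Qed.

HB.instance Definition _ := GRing.isLinear.Build R[i] K (Cn R n) _
  Cn_adjoint Cn_adjoint_linear.

Lemma hdot_CnE (x y : 'rV[R[i]]_n) :
  hdot (Cn R n) x y = \sum_j x 0 j * (y 0 j)^*.
Proof.
rewrite -[LHS]/(dotmx x y) dotmxE mxE; apply: eq_bigr => j _.
by rewrite !mxE.
Qed.

Lemma Cn_adjointP : is_adjoint V Cn_adjoint.
Proof.
move=> x y; rewrite hdot_CnE {1}(row_sum_delta x) linear_sum linear_sumlz.
apply: eq_bigr => j _; rewrite mxE -hdotC -hdotZl.
by congr (hdot K _ y); exact: linearZZ.
Qed.

End FiniteDimension.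

Lemma weak_dilates_dilates (R : realType) n (K : hilbertType R) k
    (N : k.-tuple {linear K -> K}) (T : k.-tuple {linear Cn R n -> Cn R n}) :
  weak_dilates N T -> dilates N T.
Proof.
move=> [V [Viso VN]]; exists V, (Cn_adjoint V : {linear K -> Cn R n}).
split=> // [|m x]; first exact: Cn_adjointP.
apply: hdot_inj => y; rewrite -VN.
by rewrite (is_adjoint_sym (Cn_adjointP V)).
Qed.

(** * The shift model of a contraction whose iterates tend to 0 *)

Section ShiftModel.
Variables (R : realType) (H E : hilbertType R).
Variables (a : {linear H -> H}) (D : {linear H -> E}).
Hypothesis sqrnorm_defect : forall y, sqrnorm (D y) = sqrnorm y - sqrnorm (a y).
Hypothesis iter_cvg0 : forall y, sqrnorm (iter n a y) @[n --> \oo] --> (0 : R).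

Definition model_coef (y : H) (n : int) : E :=
  match n with Posz k => D (iter k a y) | Negz _ => 0 end.

(** The defect identity makes the sum telescope. *)
Lemma psum_model y N :
  psum (fun n => sqrnorm (model_coef y n)) N = sqrnorm y - sqrnorm (iter N a y).
Proof.
elim: N => [|N IH]; first by rewrite psum0 subrr.
by rewrite psumS IH /= sqrnorm0 addr0 sqrnorm_defect addrA subrK.
Qed.

Fact model_subproof y : model_coef y \in @square_summable R E.
Proof.
apply/asboolP; exists (sqrnorm y) => N.
under [X in psum X]funext do rewrite ger0_norm ?sqrnorm_ge0//.
by rewrite psum_model gerBl sqrnorm_ge0.
Qed.

Definition model (y : H) : l2_space E := L2Space (model_subproof y).

Lemma iterP n : linear (iter n a).
Proof. by elim: n => [//|n IH] c x y; rewrite !iterS IH linearP. Qed.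

Fact model_linear : linear model.
Proof.
move=> c x y; apply: l2_ext => -[k|k].
  by rewrite -[LHS]/(D (iter k a (c *: x + y))) iterP linearP.
by rewrite -[RHS]/(c *: 0 + 0) scaler0 addr0.
Qed.

HB.instance Definition _ := GRing.isLinear.Build R[i] H (l2_space E) _
  model model_linear.

Lemma model_isometry :
  isometry (hdot (l2 E)) (hdot H) (model : {linear H -> l2 E}).
Proof.
apply: isometry_sqrnorm => y; rewrite /sqrnorm -[X in
  complex.Re X]/(l2_dot (model y) (model y)).
rewrite l2_dotE /=; apply: rsum_unique; under eq_fun do rewrite psum_model.
rewrite -/(sqrnorm y).
have h : (sqrnorm y - sqrnorm (iter N a y)) @[N --> \oo] --> sqrnorm y - 0.
  by apply: cvgB; [exact: cvg_cst|exact: iter_cvg0].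
by rewrite subr0 in h.
Qed.

(** The Hardy-space part of [l2 E]; the pencil operators preserve it because their symbols contain
    no negative power of z. *)
Definition causal (f : l2 E) : Prop := forall k, (f : l2_space E) (Negz k) = 0.

Lemma model_causal y : causal (model y).
Proof. by []. Qed.

(** In degrees n >= 0 the adjoint of the pencil operator sends [model y] to [model (S y)]: the first
    hypothesis is this equality in degree 0, and the second carries it to degree n past n factors
    [a]. *)
Lemma pencil_coextends (e : bool) (p : pencil E) (S : {linear H -> H}) :
  (forall y, pXs p (D y) + (-1) ^+ e *: pYs p (D (a y)) = D (S y)) ->
  (forall y, a (S y) = (-1) ^+ e *: S (a y)) ->
  coextends (model : H -> l2 E) causal (pencil_op e p) S.
Proof.
move=> pS aS f cf; split=> [k|y].
  rewrite pencil_opE (_ : Negz k - 1 = Negz k.+1); last lia.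
  by rewrite !cf !linear0 addr0 scaler0.
(* In negative degrees the adjoint may leave a nonzero term, which the causal [f] does not see. *)
rewrite pencil_op_is_adjoint; congr csum; apply/funext => -[k|k]; last first.
  by rewrite cf !hdot0l.
congr (hdot E _ _); rewrite pencil_op_adjE.
rewrite (_ : Posz k + 1 = Posz k.+1); last lia.
rewrite /= -iterS pS -linearZ; congr (D _).
elim: k => [|k IH]; first by rewrite /alt andbF scale1r.
rewrite [in RHS]iterS -IH (_ : Posz k.+1 = Posz k + 1); last lia.
by rewrite altS linearZ /= aS !scalerA [_ * alt _ _ _]mulrC.
Qed.

End ShiftModel.

(** * Anti-commuting unitaries *)

Section AnticommutingTriples.
Variables (R : realType) (K : hilbertType R).
Implicit Types U W : {linear K -> K}.

Lemma anticommuting3P U1 U2 U3 : anticommuting [tuple U1; U2; U3] <->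
  [/\ forall x, U1 (U2 x) = - U2 (U1 x), forall x, U1 (U3 x) = - U3 (U1 x)
    & forall x, U2 (U3 x) = - U3 (U2 x)].
Proof.
split=> [ac|[h12 h13 h23] i j]; first split.
- exact: (ac ord0 (lift ord0 ord0)).
- exact: (ac ord0 (lift ord0 (lift ord0 ord0))).
- exact: (ac (lift ord0 ord0) (lift ord0 (lift ord0 ord0))).
by case: i j => [[|[|[|//]]] i3] [[|[|[|//]]] j3].
Qed.

Lemma unitary_comp U W : unitary_op U -> unitary_op W ->
  unitary_op (U \o W : {linear K -> K}).
Proof.
move=> [Us [aU UsK UK]] [Ws [aW WsK WK]].
exists (Ws \o Us : {linear K -> K}); split.
- exact: is_adjoint_comp.
- by move=> x /=; rewrite WsK UsK.
- by move=> x /=; rewrite UK WK.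
Qed.

Lemma anticommuting_product U W :
  (forall x, U (W x) = - W (U x)) ->
  anticommuting [tuple (U \o W : {linear K -> K}); U; W].
Proof.
move=> UW; apply/anticommuting3P; split=> x /=; [|exact: UW..].
by rewrite (UW x) linearN opprK.
Qed.

Lemma is_adjoint_scale c U Us : is_adjoint U Us ->
  is_adjoint (c \*: U : {linear K -> K}) (c^* \*: Us : {linear K -> K}).
Proof. by move=> aU x y /=; rewrite hdotZl hdotZr conjCK aU. Qed.

Lemma sqrmod1_conj (c : R[i]) : sqrmod c = 1 -> c * c^* = 1.
Proof. by move=> c1; rewrite -sqrmodE c1. Qed.

Lemma unitary_scale c U : sqrmod c = 1 -> unitary_op U ->
  unitary_op (c \*: U : {linear K -> K}).
Proof.
move=> /sqrmod1_conj c1 [Us [aU UsK UK]].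
exists (c^* \*: Us : {linear K -> K}); split.
- exact: is_adjoint_scale.
- by move=> x /=; rewrite linearZ /= UsK scalerA c1 scale1r.
- by move=> x /=; rewrite linearZ /= UK scalerA mulrC c1 scale1r.
Qed.

End AnticommutingTriples.

Section ScaledUnitary.
Variables (R : realType) (K : hilbertType R).
Implicit Types U W : {linear K -> K}.

Definition pencil_cst U Us (aU : is_adjoint U Us) (UsK : cancel Us U)
  (UK : cancel U Us) : pencil K.
Proof.
by refine (@Pencil _ _ U \0 Us \0 _ _ _ _ _ _ _ _) => // [x y|x|x|x|x] /=;
  rewrite ?hdot0l ?hdot0r ?addr0 ?linear0.
Defined.

Definition pencil_lin U Us (aU : is_adjoint U Us) (UsK : cancel Us U)
  (UK : cancel U Us) : pencil K.
Proof.
by refine (@Pencil _ _ \0 U \0 Us _ _ _ _ _ _ _ _) => // [x y|x|x|x|x] /=;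
  rewrite ?hdot0l ?hdot0r ?add0r ?linear0.
Defined.

(* A scalar contraction in front of the first unitary is absorbed by a tensor
   product with its minimal unitary dilation, the bilateral shift. *)
Lemma scaled_unitary_dilation c U1 U2 U3 : sqrmod c <= 1 ->
  anticommuting [tuple U1; U2; U3] ->
  unitary_op U1 -> unitary_op U2 -> unitary_op U3 ->
  exists (L : hilbertType R) (W1 W2 W3 : {linear L -> L}),
    [/\ anticommuting [tuple W1; W2; W3],
        [/\ unitary_op W1, unitary_op W2 & unitary_op W3]
      & weak_dilates [tuple W1; W2; W3]
          [tuple (c \*: U1 : {linear K -> K}); U2; U3]].
Proof.
move=> c1 /anticommuting3P[ac12 ac13 ac23] uU1 uU2 uU3.
(* When |c| = 1 the powers of c do not decay, but [c \*: U1] is itself unitary. *)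
have [ceq|cneq] := eqVneq (sqrmod c) 1.
  exists K, (c \*: U1 : {linear K -> K}), U2, U3; split.
  - apply/anticommuting3P; split=> x /=; last exact: ac23.
      by rewrite ac12 scalerN (linearZZ U2).
    by rewrite ac13 scalerN (linearZZ U3).
  - by split=> //; exact: unitary_scale.
  - exact: weak_dilates_refl.
have {c1 cneq} c1 : sqrmod c < 1 by rewrite lt_neqAle cneq.
move: uU1 uU2 uU3 => [S1 [a1 S1K U1K]] [S2 [a2 S2K U2K]] [S3 [a3 S3K U3K]].
(* The shift model is built on the scalar operator conj c, whose defect is [d] = sqrt (1 -
   |c|^2). *)
pose a : {linear K -> K} := c^* \*: idfun.
pose d : R[i] := (Num.sqrt (1 - sqrmod c))%:C%C.
have dd : sqrmod d = 1 - sqrmod c.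
  by rewrite /sqrmod /= expr0n addr0 sqr_sqrtr// subr_ge0 ltW.
pose D : {linear K -> K} := d \*: idfun.
have aD y : sqrnorm (D y) = sqrnorm y - sqrnorm (a y).
  by rewrite /= !sqrnormZ dd sqrmod_conj mulrBl mul1r.
have iterE k y : sqrnorm (iter k a y) = sqrmod c ^+ k * sqrnorm y.
  elim: k => [|k IH]; first by rewrite expr0 mul1r.
  by rewrite iterS /= sqrnormZ IH sqrmod_conj exprS mulrA.
have a0 y : sqrnorm (iter k a y) @[k --> \oo] --> (0 : R).
  under eq_fun do rewrite iterE.
  rewrite -(mul0r (sqrnorm y)); apply: cvgM; last exact: cvg_cst.
  by apply: cvg_expr; rewrite ger0_norm ?sqrmod_ge0.
(* [W1] is the bilateral shift tensored with [U1], while [W2] and [W3] act in each degree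
   separately. *)
pose W1 := pencil_op false (pencil_lin a1 S1K U1K).
pose W2 := pencil_op false (pencil_cst a2 S2K U2K).
pose W3 := pencil_op false (pencil_cst a3 S3K U3K).
exists (l2 K), W1, W2, W3; split.
- apply/anticommuting3P; split=> f; apply: (@l2_ext _ K) => n;
    rewrite l2N !pencil_opE /alt /= !scale1r ?addr0 ?add0r ?scale1r.
  + by rewrite ac12.
  + by rewrite ac13.
  + by rewrite ac23.
- by split; exact: pencil_op_unitary.
apply: (@coextends_weak_dilates R K (l2 K) (model aD : {linear K -> l2 K})
  (@causal R K) W1 W2 W3 (c \*: U1 : {linear K -> K}) U2 U3
  (c^* \*: S1 : {linear K -> K}) S2 S3) => //.
- exact: (model_isometry aD a0).
- exact: is_adjoint_scale.
- apply: (pencil_coextends aD) => y /=.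
    by rewrite add0r expr0 scale1r !linearZ /= !scalerA mulrC.
  by rewrite expr0 scale1r !linearZ /=.
- apply: (pencil_coextends aD) => y /=.
    by rewrite scaler0 addr0 linearZ.
  by rewrite expr0 scale1r linearZ.
- apply: (pencil_coextends aD) => y /=.
    by rewrite scaler0 addr0 linearZ.
  by rewrite expr0 scale1r linearZ.
Qed.

End ScaledUnitary.

(** * Matrices *)

Section MatrixLemmas.
Local Open Scope sesquilinear_scope.
Variable C : numClosedFieldType.

Lemma trmxC_mul m n p (A : 'M[C]_(m, n)) (B : 'M[C]_(n, p)) :
  (A *m B)^t* = B^t* *m A^t*.
Proof. by rewrite trmx_mul map_mxM. Qed.

Lemma dotmx_mulE n (u v : 'rV[C]_n) : u *m v^t* = (dotmx u v)%:M.
Proof. by rewrite dotmxE -mx11_scalar. Qed.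

Lemma dotmxC n (u v : 'rV[C]_n) : dotmx v u = (dotmx u v)^*.
Proof. by rewrite (hermC (dotmx (n := n))) expr0 mul1r. Qed.

(* A complex Householder reflection. *)
Lemma unitary_map_vector n (a b : 'rV[C]_n) : dotmx a a = dotmx b b ->
  exists G : 'M[C]_n, [/\ G \is unitarymx, a *m G = b
    & forall x : 'rV_n, dotmx x (a - b) = 0 -> x *m G = x].
Proof.
move=> ab; have [->|nab] := eqVneq a b.
  exists 1%:M; split=> [||x _]; rewrite ?mulmx1//.
  by apply/unitarymxP; rewrite trmx1 map_mx1 mulmx1.
(* Equal norms give |d|^2 = t + conj t. This makes 1 - d* d / t unitary, where a real reflection has
   the factor 2 / |d|^2, and [a] is sent to a - d = b. *)
set d := a - b; pose t := dotmx a d.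
have tE : dotmx d d = t + t^*.
  rewrite {1}/d linearBl -/t -[t^*]dotmxC; congr (_ + _).
  by rewrite /d linearBr linearBl /= ab opprB.
have d0 : d != 0 by rewrite subr_eq0.
have t0 : t != 0.
  apply: contraNneq d0 => t0; rewrite -(dnorm_eq0 (dotmx (n := n))).
  by rewrite /= tE t0 conjC0 addr0.
pose P := d^t* *m d.
have PP : P *m P = (t + t^*) *: P.
  by rewrite /P mulmxA -(mulmxA _ d) dotmx_mulE tE mul_mx_scalar scalemxAl.
have PC : P^t* = P by rewrite /P trmxC_mul trmxCK.
have actE (x : 'rV_n) : x *m (1%:M - t^-1 *: P) = x - (t^-1 * dotmx x d) *: d.
  by rewrite mulmxBr mulmx1 -scalemxAr mulmxA dotmx_mulE mul_scalar_mx scalerA.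
exists (1%:M - t^-1 *: P); split=> [||x xd].
- apply/unitarymxP; rewrite linearB /= [(_ *: P)^T]linearZ /= map_mxB map_mxZ
    trmx1 map_mx1 PC.
  rewrite mulmxBl mul1mx mulmxBr mulmx1 -scalemxAl -scalemxAr PP !scalerA.
  rewrite -scalerBl -addrA -opprD -scalerDl [X in X *: P](_ : _ = 0).
    by rewrite scale0r subr0.
  have tc0 : t^* != 0 by rewrite conjC_eq0.
  by rewrite fmorphV; field; rewrite t0 tc0.
- by rewrite actE -/t mulVf// scale1r opprB addrC subrK.
- by rewrite actE xd mulr0 scale0r subr0.
Qed.

Lemma mulmx_trmxCE m n p (A : 'M[C]_(m, n)) (B : 'M[C]_(p, n)) i j :
  (A *m B^t*) i j = dotmx (row i A) (row j B).
Proof. by rewrite dotmxE !mxE; apply: eq_bigr => k _; rewrite !mxE. Qed.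

(** Rows are matched one at a time: a reflection sends the image of the next row of [A] to the row
    of [B], and fixes the rows already matched because equal Gram matrices make them orthogonal to
    the difference. *)
Lemma gram_unitary m n (A B : 'M[C]_(m, n)) : A *m A^t* = B *m B^t* ->
  exists2 G : 'M[C]_n, G \is unitarymx & A *m G = B.
Proof.
move=> AB.
have gram i j : dotmx (row i A) (row j A) = dotmx (row i B) (row j B).
  by rewrite -!mulmx_trmxCE AB.
have H k : exists2 G : 'M[C]_n, G \is unitarymx &
    forall i : 'I_m, (i < k)%N -> row i A *m G = row i B.
  elim: k => [|k [G uG GE]].
    by exists 1%:M => //; apply/unitarymxP; rewrite trmx1 map_mx1 mulmx1.
  have [km|mk] := ltnP k m; last first.
    by exists G => // i ik; apply: GE; exact: leq_trans (ltn_ord i) mk.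
  pose i0 := Ordinal km.
  have dG (x y : 'rV_n) : dotmx (x *m G) (y *m G) = dotmx x y.
    rewrite !dotmxE trmxC_mul mulmxA -(mulmxA x).
    by rewrite (unitarymxP uG) mulmx1.
  have [|W [uW W0 Wi]] := @unitary_map_vector n (row i0 A *m G) (row i0 B).
    by rewrite dG gram.
  exists (G *m W); first exact: mul_unitarymx.
  move=> i; rewrite ltnS leq_eqVlt => /orP[/eqP ik|ik].
    by rewrite (_ : i = i0) ?mulmxA//; exact: val_inj.
  rewrite mulmxA GE// Wi// linearBr /= -{1}[row i B]GE//.
  by rewrite dG gram subrr.
have [G uG GE] := H m.
by exists G => //; apply/row_matrixP => i; rewrite row_mul; exact: GE.
Qed.

(** Spectral theorem for 1 - M M*, taking square roots of its eigenvalues. *)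
Lemma defect_root n (M : 'M[C]_n) :
  (forall x : 'rV_n, dotmx (x *m M) (x *m M) <= dotmx x x) ->
  exists Q : 'M[C]_n, Q *m Q^t* = 1%:M - M *m M^t*.
Proof.
move=> cM; pose A := 1%:M - M *m M^t*.
have AC : A^t* = A.
  by rewrite /A linearB /= map_mxB trmx1 map_mx1 trmxC_mul trmxCK.
have /orthomx_spectralP AE : A \is normalmx by apply/normalmxP; rewrite AC.
set P := spectralmx A in AE; set d := spectral_diag A in AE.
have uP : P \is unitarymx := spectral_unitarymx A.
have PV : P *m P^t* = 1%:M := unitarymxP uP.
have PAP : P *m A *m P^t* = diag_mx d.
  by rewrite AE invmx_unitary// !mulmxA PV mul1mx -mulmxA PV mulmx1.
(* Each eigenvalue is |p|^2 - |p M|^2 for a row p of [P]. *)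
have d_ge0 i : 0 <= d 0 i.
  have /matrixP/(_ i i) := PAP; rewrite [RHS]mxE eqxx mulr1n => <-.
  rewrite /A mulmxBr mulmx1 mulmxBl mxE [in X in _ + X]mxE.
  rewrite mulmxA -mulmxA -trmxC_mul !mulmx_trmxCE row_mul subr_ge0; exact: cM.
pose s := \row_i sqrtC (d 0 i).
exists (P^t* *m diag_mx s).
rewrite -/A AE invmx_unitary// trmxC_mul trmxCK !mulmxA; congr (_ *m _).
rewrite -mulmxA tr_diag_mx map_diag_mx mulmx_diag; congr (_ *m diag_mx _).
apply/rowP => i; rewrite !mxE.
have /CrealP sR : sqrtC (d 0 i) \is Num.real by rewrite ger0_real// sqrtC_ge0.
by rewrite [X in _ * X]sR -expr2 sqrtCK.
Qed.

(** An eigenspace of [B] is stable under [M] and [N]. If it were a line, it would be spanned by a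
    common eigenvector with eigenvalues l and k; anti-commutation then gives l k = 0, against
    invertibility. *)
Lemma anticommuting_irreducible (M N B : 'M[C]_2) :
  M \in unitmx -> N \in unitmx -> M *m N = - (N *m M) ->
  B *m M = M *m B -> B *m N = N *m B -> exists c, B = c%:M.
Proof.
move=> uM uN MN BM BN.
have [c cB] := eigenvalue_closed B isT.
exists c; have /eigenvalueP[v vB v0] := cB.
pose E := eigenspace B c.
have stable X : B *m X = X *m B -> (E *m X <= E)%MS.
  move=> BX; apply/eigenspaceP; rewrite -mulmxA -BX mulmxA.
  by rewrite (eigenspaceP (submx_refl _)) scalemxAl.
have vE : (v <= E)%MS by apply/eigenspaceP.
have [fE|] := boolP (row_full E).
  have /eigenspaceP : (1%:M <= eigenspace B c)%MS by rewrite sub1mx.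
  by rewrite mul1mx scalemx1.
move=> nE; have rE : (\rank E <= \rank v)%N.
  rewrite rank_rV v0; move: nE; rewrite /row_full => nE.
  have := rank_leq_col E; lia.
have Ev : (E <= v)%MS by rewrite -(geq_leqif (mxrank_leqif_sup vE)).
have line X : B *m X = X *m B -> exists l, v *m X = l *: v.
  move=> BX; apply/sub_rVP; apply: submx_trans Ev;
    apply: submx_trans (stable X BX).
  exact: submxMr.
have [l vM] := line M BM; have [k vN] := line N BN.
have vMN : v *m (M *m N) = (l * k) *: v by rewrite mulmxA vM -scalemxAl vN
  scalerA.
have : v *m (M *m N) = 0.
  have e : (l * k) *: v = - ((l * k) *: v).
    by rewrite -{1}vMN MN mulmxN mulmxA vN -scalemxAl vM scalerA mulrC.
  have /eqP : (2 * (l * k)) *: v = 0 by rewrite mulr_natl mulr2n scalerDl {1}e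
    addNr.
  rewrite scaler_eq0 (negPf v0) orbF mulf_eq0 pnatr_eq0 /= => /eqP lk.
  by rewrite vMN lk scale0r.
move=> /(congr1 (mulmx^~ (invmx (M *m N)))); rewrite mulmxK ?unitmx_mul ?uM//.
by rewrite mul0mx => vz; rewrite vz eqxx in v0.
Qed.

End MatrixLemmas.

(** * The pencils attached to a unitary matrix *)

Section MatrixOperators.
Local Open Scope sesquilinear_scope.
Variable R : realType.

(* Matrices act on row vectors, from the right: products are reversed with
   respect to composition of operators. *)
Definition mxop m n (M : 'M[R[i]]_(m, n)) :
  {linear Cn R m -> Cn R n} := mulmxr M.

Lemma mxop_adjoint m n (M : 'M[R[i]]_(m, n)) :
  is_adjoint (mxop M) (mxop (M^t* )).
Proof.
move=> x y; rewrite -[LHS]/(dotmx (x *m M) y) -[RHS]/(dotmx x (y *m M^t*)).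
by rewrite !dotmxE trmxC_mul trmxCK mulmxA.
Qed.

Definition is_mx_pencil n (X Y : 'M[R[i]]_n) : Prop :=
  [/\ X *m X^t* + Y *m Y^t* = 1%:M, X *m Y^t* = 0,
      X^t* *m X + Y^t* *m Y = 1%:M & X^t* *m Y = 0].

Definition mx_pencil n (X Y : 'M[R[i]]_n) (XY : is_mx_pencil X Y) :
  pencil (Cn R n).
Proof.
refine (@Pencil _ _ (mxop X) (mxop Y) (mxop (X^t* )) (mxop (Y^t* ))
  (mxop_adjoint X) (mxop_adjoint Y) _ _ _ _ _ _) => x /=; rewrite -!mulmxA;
  case: XY => l1 l2 r1 r2.
- by rewrite -mulmxDr l1 mulmx1.
- by rewrite -[X in _ *m X]trmxCK trmxC_mul trmxCK l2 trmx0 map_mx0 mulmx0.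
- by rewrite l2 mulmx0.
- by rewrite -mulmxDr r1 mulmx1.
- by rewrite -[X in _ *m X]trmxCK trmxC_mul trmxCK r2 trmx0 map_mx0 mulmx0.
- by rewrite r2 mulmx0.
Defined.

Section HalfSwap.
Variable k : nat.

(** On row vectors [swap12] sends (x, y) to (0, x) and [swap21] sends it to (y, 0): they are Q and P
    of the header. *)
Definition swap12 : 'M[R[i]]_(k + k) := block_mx 0 1%:M 0 0.
Definition swap21 : 'M[R[i]]_(k + k) := block_mx 0 0 1%:M 0.

Lemma swap12C : swap12^t* = swap21.
Proof.
by rewrite tr_block_mx map_block_mx !trmx0 trmx1 !map_mx0 map_mx1.
Qed.

Lemma swap21C : swap21^t* = swap12.
Proof. by rewrite -swap12C trmxCK. Qed.

Lemma swap12_sqr : swap12 *m swap12 = 0.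
Proof.
by rewrite mulmx_block !(mul0mx, mulmx0, addr0, add0r) -block_mx0.
Qed.

Lemma swap21_sqr : swap21 *m swap21 = 0.
Proof.
by rewrite mulmx_block !(mul0mx, mulmx0, addr0, add0r) -block_mx0.
Qed.

Lemma swap_sum : swap21 *m swap12 + swap12 *m swap21 = 1%:M.
Proof.
rewrite !mulmx_block !(mul0mx, mulmx0, mulmx1, addr0, add0r) add_block_mx.
by rewrite !(addr0, add0r) -scalar_mx_block.
Qed.

Lemma swap_conj_sum (G : 'M[R[i]]_(k + k)) : G \is unitarymx ->
  G *m swap21 *m swap12 *m G^t* + G *m swap12 *m swap21 *m G^t* = 1%:M.
Proof.
move=> uG; rewrite -mulmxDl -!(mulmxA G) -mulmxDr swap_sum mulmx1.
exact: unitarymxP.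
Qed.

Variable G : 'M[R[i]]_(k + k).
Hypothesis uG : G \is unitarymx.

Let GK n (x : 'M[R[i]]_(n, k + k)) : x *m G *m G^t* = x.
Proof. by rewrite -mulmxA (unitarymxP uG) mulmx1. Qed.

Let KG n (x : 'M[R[i]]_(n, k + k)) : x *m G^t* *m G = x.
Proof. by rewrite -mulmxA (mulmx1C (unitarymxP uG)) mulmx1. Qed.

Fact left_pencil_subproof : is_mx_pencil (swap21 *m G^t*) (- (swap12 *m G^t*)).
Proof.
have XC : (swap21 *m G^t*)^t* = G *m swap12 by rewrite trmxC_mul trmxCK swap21C.
have YC : (- (swap12 *m G^t*))^t* = - (G *m swap21).
  by rewrite [(- _)^T]linearN map_mxN /= trmxC_mul trmxCK swap12C.
split; rewrite ?YC ?XC ?(mulmxN, mulNmx) ?opprK !mulmxA ?KG.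
- exact: swap_sum.
- by rewrite swap21_sqr oppr0.
- by rewrite addrC swap_conj_sum.
- by rewrite -(mulmxA G) swap12_sqr mulmx0 mul0mx oppr0.
Qed.

Fact right_pencil_subproof : is_mx_pencil (G *m swap21) (G *m swap12).
Proof.
split; rewrite !trmxC_mul ?swap12C ?swap21C !mulmxA ?KG.
- exact: swap_conj_sum.
- by rewrite -(mulmxA G) swap21_sqr mulmx0 mul0mx.
- by rewrite addrC swap_sum.
- by rewrite swap12_sqr.
Qed.

Definition left_pencil := mx_pencil left_pencil_subproof.
Definition right_pencil := mx_pencil right_pencil_subproof.

Definition left_unitary := pencil_op true left_pencil.
Definition right_unitary := pencil_op true right_pencil.

Lemma left_unitaryE (f : l2_space (Cn R (k + k))) n :
  (left_unitary f : l2_space _) n =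
  alt R true n *: ((f n : 'rV_(k + k)) *m (swap21 *m G^t*) -
                   (f (n - 1) : 'rV_(k + k)) *m (swap12 *m G^t*)) :>
                     'rV[R[i]]_(k + k).
Proof. by rewrite pencil_opE -mulmxN. Qed.

Lemma right_unitaryE (f : l2_space (Cn R (k + k))) n :
  (right_unitary f : l2_space _) n =
  alt R true n *: ((f n : 'rV_(k + k)) *m (G *m swap21) +
                   (f (n - 1) : 'rV_(k + k)) *m (G *m swap12)) :>
                     'rV[R[i]]_(k + k).
Proof. by rewrite pencil_opE. Qed.

Section PencilProducts.
Variables (s : R[i]) (x0 x1 x2 : 'rV[R[i]]_(k + k)).
Hypothesis ss : s * s = 1.

(** Degree n of the product: [x0], [x1], [x2] are the coefficients in degrees n, n - 1, n - 2, and
    [s] is the sign in degree n, hence [- s] in degree n - 1. *)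
Lemma left_right_row :
  s *: ((s *: (x0 *m (G *m swap21) + x1 *m (G *m swap12))) *m (swap21 *m G^t*) -
    (- s *: (x1 *m (G *m swap21) + x2 *m (G *m swap12))) *m (swap12 *m G^t*)) =
      x1.
Proof.
rewrite !scaleNr mulNmx opprK -!scalemxAl -scalerDr scalerA ss scale1r.
rewrite !mulmxDl !mulmxA -!(mulmxA _ swap21 swap21) -!(mulmxA _ swap12 swap12).
rewrite swap21_sqr swap12_sqr !mulmx0 !mul0mx add0r addr0 -mulmxDl.
rewrite -(mulmxA _ swap12 swap21) -(mulmxA _ swap21 swap12) -mulmxDr.
by rewrite [swap12 *m _ + _]addrC swap_sum mulmx1 GK.
Qed.

Lemma right_left_row :
  s *: ((s *: (x0 *m (swap21 *m G^t*) - x1 *m (swap12 *m G^t*))) *m (G *m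
    swap21) +
    (- s *: (x1 *m (swap21 *m G^t*) - x2 *m (swap12 *m G^t*))) *m (G *m
      swap12)) = - x1.
Proof.
rewrite !scaleNr mulNmx -!scalemxAl -scalerBr scalerA ss scale1r.
rewrite !mulmxBl !mulmxA !KG -!(mulmxA _ swap21 swap21) -!(mulmxA _ swap12
  swap12).
rewrite swap21_sqr swap12_sqr !mulmx0 sub0r subr0 -opprD.
rewrite -(mulmxA _ swap12 swap21) -(mulmxA _ swap21 swap12) -mulmxDr.
by rewrite [swap12 *m _ + _]addrC swap_sum mulmx1.
Qed.

End PencilProducts.

(** Conjugation by the signs replaces z by -z, so the product has symbol G* (P + z Q)^2 G = z, by
    P^2 = Q^2 = 0 and P Q + Q P = 1. *)
Lemma left_rightE f : left_unitary (right_unitary f) = l2_shift f.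
Proof.
apply: (@l2_ext _ (Cn R (k + k))) => n.
rewrite left_unitaryE !right_unitaryE altP expr1 mulN1r.
by apply: left_right_row; rewrite -expr2 sqrr_sign.
Qed.

(** In this order G G* cancels in the middle and the symbol is (P - z Q)^2 = -z. *)
Lemma right_leftE f : right_unitary (left_unitary f) = - l2_shift f :> l2 _.
Proof.
apply: (@l2_ext _ (Cn R (k + k))) => n.
rewrite right_unitaryE !left_unitaryE altP expr1 mulN1r.
by apply: right_left_row; rewrite -expr2 sqrr_sign.
Qed.

Lemma left_right_anticommute f :
  left_unitary (right_unitary f) = - right_unitary (left_unitary f).
Proof.
apply: etrans (left_rightE f) _; apply: etrans (esym (opprK _)) _.
by congr (- _); exact: esym (right_leftE f).
Qed.

End HalfSwap.
End MatrixOperators.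

(** * Dilation of a pair *)

Section PureDilation.
Local Open Scope sesquilinear_scope.
Variable R : realType.

(** Cauchy-Schwarz gives |S y|^2 = <T S y, y> <= |S y| |y|; then divide by |S y|. *)
Lemma adjoint_contractive (H : hilbertType R) (T S : {linear H -> H}) :
  is_adjoint T S -> contractive T -> contractive S.
Proof.
move=> TS cT y; rewrite -ler_hnorm.
have [->|n0] := eqVneq (hnorm (S y)) 0; first exact: hnorm_ge0.
have n_gt0 : 0 < hnorm (S y) by rewrite lt_neqAle eq_sym n0 hnorm_ge0.
rewrite -(ler_pM2r n_gt0) -expr2 sqr_hnorm /sqrnorm -TS.
apply: le_trans (Re_hdot_CauchySchwarz _ _) _.
by rewrite mulrC ler_wpM2l ?hnorm_ge0// ler_hnorm.
Qed.

Lemma contractive_dotmx n (M : 'M[R[i]]_n) : contractive (mxop M) ->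
  forall x : 'rV_n, dotmx (x *m M) (x *m M) <= dotmx x x.
Proof.
move=> cM x; have := cM x.
by rewrite -lecR -!hdotE.
Qed.

Lemma sqrnorm_mxop m n (M : 'M[R[i]]_(m, n)) (x : 'rV_m) :
  sqrnorm (mxop M x) = complex.Re ((x *m (M *m M^t*) *m x^t*) 0 0).
Proof.
rewrite /sqrnorm -[X in complex.Re X]/(dotmx (x *m M) (x *m M)) dotmxE.
by rewrite trmxC_mul !mulmxA.
Qed.

Lemma sqrnorm_CnE n (x : 'rV[R[i]]_n) :
  sqrnorm (x : Cn R n) = complex.Re ((x *m x^t*) 0 0).
Proof. by rewrite /sqrnorm -[X in complex.Re X]/(dotmx x x) dotmxE. Qed.

(** The squared norms decrease to a limit l, and passing from n to n + 2 gives l = |c|^2 l, so l =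
    0. *)
Lemma contractive_iter2_cvg0 (H : hilbertType R) (a : {linear H -> H}) (c :
  R[i]) y :
  contractive a -> sqrmod c < 1 -> (forall x, a (a x) = c *: x) ->
  sqrnorm (iter n a y) @[n --> \oo] --> (0 : R).
Proof.
move=> ca c1 aa.
pose u n := sqrnorm (iter n a y).
have du : nonincreasing_seq u by apply/nonincreasing_seqP => n; exact: ca.
have cu : cvgn u.
  apply: nonincreasing_is_cvgn => //; exists 0 => _ [n _ <-];
    exact: sqrnorm_ge0.
have u2 : (fun n => u n.+2) = (fun n => sqrmod c * u n).
  by apply/funext => n; rewrite /u !iterS aa sqrnormZ.
have l1 : u n.+2 @[n --> \oo] --> limn u.
  by rewrite (cvg_shiftS (fun n => u n.+1)) (cvg_shiftS u).
have l2 : u n.+2 @[n --> \oo] --> sqrmod c * limn u.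
  by rewrite u2; apply: cvgM => //; exact: cvg_cst.
have /eqP : limn u = sqrmod c * limn u by exact: (cvg_unique (@Rhausdorff R) l1
  l2).
rewrite -subr_eq0 -{1}(mul1r (limn u)) -mulrBl mulf_eq0 subr_eq0.
rewrite (gt_eqF c1) /= => /eqP l0.
by rewrite -l0; exact: cu.
Qed.

Section PurePair.
Variables (T2 T3 : {linear Cn R 2 -> Cn R 2}) (M N : 'M[R[i]]_2) (c : R[i]).
Hypotheses (T2E : forall x, T2 x = mxop M x) (T3E : forall x, T3 x = mxop N x).
Hypotheses (cT2 : contractive T2) (cT3 : contractive T3).
Hypothesis MN : N *m M = - (M *m N).
Hypothesis MN2 : (N *m M) *m (N *m M) = c%:M.
Hypothesis c_lt1 : sqrmod c < 1.

(** The product is dilated along with the pair, because the first operator of the triple is a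
    multiple of it. *)
Lemma pure_pair_dilation : exists (K : hilbertType R) (U2 U3 : {linear K -> K}),
  [/\ forall x, U2 (U3 x) = - U3 (U2 x), unitary_op U2, unitary_op U3
    & weak_dilates [tuple (U2 \o U3 : {linear K -> K}); U2; U3]
        [tuple (T2 \o T3 : {linear Cn R 2 -> Cn R 2}); T2; T3]].
Proof.
pose S2 := mxop (M^t* ); pose S3 := mxop (N^t* ).
have a2 : is_adjoint T2 S2 by move=> x y; rewrite T2E mxop_adjoint.
have a3 : is_adjoint T3 S3 by move=> x y; rewrite T3E mxop_adjoint.
have cS2 := adjoint_contractive a2 cT2; have cS3 := adjoint_contractive a3 cT3.
(* The roots are taken for the adjoints, so [Q2] and [Q3] represent D_2 and D_3 of the header. *)
have [Q2 Q2E] := defect_root (contractive_dotmx cS2).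
have [Q3 Q3E] := defect_root (contractive_dotmx cS3).
rewrite trmxCK in Q2E; rewrite trmxCK in Q3E.
have MNC : M^t* *m N^t* = - (N^t* *m M^t*).
  by rewrite -!trmxC_mul MN [(- _)^T]linearN map_mxN.
(* [Dm] and [Dm'] are the maps D and D' of the header. *)
pose Dm : 'M[R[i]]_(2, 2 + 2) := row_mx (N^t* *m Q2) Q3.
pose Dm' : 'M[R[i]]_(2, 2 + 2) := row_mx (M^t* *m Q3) Q2.
(* Since products are reversed, this is the matrix of the adjoint of T2 T3, that is, A* of the
   header. *)
pose A := M^t* *m N^t*.
have AC : A^t* = N *m M by rewrite trmxC_mul !trmxCK.
(* The two defects telescope: the term in B* B produced by the first half cancels the one in the
   second half. *)
have gram (B X Y : 'M[R[i]]_2) Q : Q *m Q^t* = 1%:M - X^t* *m X ->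
    Y *m Y^t* = 1%:M - B^t* *m B ->
    row_mx (B^t* *m Q) Y *m (row_mx (B^t* *m Q) Y)^t* =
    1%:M - (B^t* *m X^t*) *m (X *m B).
  move=> QE YE; rewrite tr_row_mx map_col_mx mul_row_col YE trmxC_mul trmxCK.
  rewrite mulmxA -(mulmxA (B^t* )) QE mulmxBr mulmx1 mulmxBl !mulmxA.
  by rewrite [LHS]addrC; exact: subrKA.
have gD : Dm *m Dm^t* = 1%:M - A *m A^t*.
  by rewrite /Dm (gram _ N M _ _ Q2E Q3E) AC /A MNC MN mulmxN mulNmx opprK.
have gD' : Dm' *m Dm'^t* = 1%:M - A *m A^t*.
  by rewrite AC; exact: gram Q3E Q2E.
have [G uG DG] := gram_unitary (etrans gD (esym gD')).
pose a := mxop A; pose D := mxop Dm.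
have aD y : sqrnorm (D y) = sqrnorm y - sqrnorm (a y).
  rewrite !sqrnorm_mxop gD mulmxBr mulmx1 mulmxBl sqrnorm_CnE.
  by rewrite mxE complex_ReD [in X in _ + X]mxE complex_ReN.
have ca : contractive a by move=> y; have := sqrnorm_ge0 (D y);
  rewrite aD subr_ge0.
have a0 y : sqrnorm (iter n a y) @[n --> \oo] --> (0 : R).
  apply: (@contractive_iter2_cvg0 _ a (c^* )) => //;
    first by rewrite sqrmod_conj.
  move=> x; rewrite -[LHS]/(x *m A *m A) -mulmxA.
  by rewrite -(trmxCK (A *m A)) trmxC_mul AC MN2 tr_scalar_mx map_scalar_mx
    mul_mx_scalar.
have s12 (X Y : 'M[R[i]]_2) : row_mx X Y *m swap12 R 2 = row_mx 0 X.
  by rewrite mul_row_block !mulmx0 mulmx1 !addr0.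
have s21 (X Y : 'M[R[i]]_2) : row_mx X Y *m swap21 R 2 = row_mx Y 0.
  by rewrite mul_row_block !mulmx0 mulmx1 !add0r.
have AM : M^t* *m A = - (A *m M^t*) by rewrite /A -(mulmxA (M^t* )) -mulmxN
  -MNC.
have AN : N^t* *m A = - (A *m N^t*).
  by rewrite /A mulmxA -mulNmx MNC opprK.
have rel2 : Dm *m (G *m swap12 R 2) + A *m (Dm *m (G *m swap21 R 2)) =
  M^t* *m Dm.
  rewrite !(mulmxA Dm) DG s12 s21 !mul_mx_row mulmx0 add_row_mx add0r addr0.
  by rewrite /A mulmxA.
have rel3 : Dm *m (swap12 R 2 *m G^t*) - A *m (Dm *m (swap21 R 2 *m G^t*)) =
  N^t* *m Dm.
  rewrite !(mulmxA Dm) s12 s21 (mulmxA A) -mulmxBl mul_mx_row mulmx0 opp_row_mx.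
  rewrite add_row_mx add0r oppr0 addr0 /A MNC mulNmx opprK -mulmxA.
  have -> : Dm = Dm' *m G^t* by rewrite -DG -mulmxA (unitarymxP uG) mulmx1.
  by rewrite [RHS]mulmxA /Dm' mul_mx_row.
pose U2 := left_unitary uG; pose U3 := right_unitary uG.
have U23 f : U2 (U3 f) = - U3 (U2 f) by exact: left_right_anticommute.
have co2 : coextends (model aD : Cn R 2 -> l2 _) (@causal R _) U2 S2.
  apply: (pencil_coextends aD) => y; rewrite expr1 scaleN1r.
    rewrite -[LHS]/(y *m Dm *m (swap21 R 2 *m G^t*)^t* -
      y *m A *m Dm *m (- (swap12 R 2 *m G^t*))^t*) -[RHS]/(y *m M^t* *m Dm).
    rewrite [(- _)^T]linearN map_mxN mulmxN opprK !trmxC_mul !trmxCK swap12C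
      swap21C.
    by rewrite -!(mulmxA y) -mulmxDr -!(mulmxA A) rel2.
  rewrite -[LHS]/(y *m M^t* *m A) -[RHS]/(- (y *m A *m M^t*)).
  by rewrite -(mulmxA y) AM mulmxN mulmxA.
have co3 : coextends (model aD : Cn R 2 -> l2 _) (@causal R _) U3 S3.
  apply: (pencil_coextends aD) => y; rewrite expr1 scaleN1r.
    rewrite -[LHS]/(y *m Dm *m (G *m swap21 R 2)^t* -
      y *m A *m Dm *m (G *m swap12 R 2)^t*) -[RHS]/(y *m N^t* *m Dm).
    by rewrite !trmxC_mul swap12C swap21C -!(mulmxA y) -mulmxBr -!(mulmxA A)
      rel3.
  rewrite -[LHS]/(y *m N^t* *m A) -[RHS]/(- (y *m A *m N^t*)).
  by rewrite -(mulmxA y) AN mulmxN mulmxA.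
exists (l2 (Cn R (2 + 2))), U2, U3.
split; [exact: U23|exact: pencil_op_unitary|exact: pencil_op_unitary|].
apply: (@coextends_weak_dilates R (Cn R 2) (l2 (Cn R (2 + 2)))
  (model aD : {linear Cn R 2 -> l2 (Cn R (2 + 2))}) (@causal R (Cn R (2 + 2)))
  (U2 \o U3 : {linear l2 (Cn R (2 + 2)) -> l2 (Cn R (2 + 2))}) U2 U3
  (T2 \o T3 : {linear Cn R 2 -> Cn R 2}) T2 T3
  (S3 \o S2 : {linear Cn R 2 -> Cn R 2}) S2 S3).
- exact: (model_isometry aD a0).
- exact: model_causal.
- exact: is_adjoint_comp.
- exact: a2.
- exact: a3.
- exact: (coextends_comp co2 co3).
- exact: co2.
- exact: co3.
Qed.

End PurePair.
End PureDilation.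

(** * Dilation of the triple *)

Lemma iter_scale (R : realType) (H : hilbertType R) (U W : {linear H -> H})
    (c : R[i]) n x :
  (forall y, W y = c *: U y) -> iter n W x = c ^+ n *: iter n U x.
Proof.
move=> WE; elim: n => [|n IH]; first by rewrite expr0 scale1r.
by rewrite !iterS WE IH linearZ scalerA -exprS.
Qed.

Lemma weak_dilates_scale (R : realType) (H K : hilbertType R) (c : R[i])
    (N1 N1' N2 N3 : {linear K -> K}) (T1 T1' T2 T3 : {linear H -> H}) :
  (forall x, N1' x = c *: N1 x) -> (forall x, T1' x = c *: T1 x) ->
  weak_dilates [tuple N1; N2; N3] [tuple T1; T2; T3] ->
  weak_dilates [tuple N1'; N2; N3] [tuple T1'; T2; T3].
Proof.
move=> NE TE [V [Viso VN]]; exists V; split=> // m x y.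
have := VN m x y; rewrite !monomial3E => VNm.
by rewrite (iter_scale _ _ NE) (iter_scale _ _ TE) !hdotZl VNm.
Qed.

Section OperatorNorm.
Variables (R : realType) (H K : hilbertType R).

Lemma hnormZ (c : R[i]) (x : H) : hnorm (c *: x) =
  Num.sqrt (sqrmod c) * hnorm x.
Proof.
rewrite /hnorm /dot_norm -!/(sqrnorm _) -sqrtrM ?sqrmod_ge0//.
by congr Num.sqrt; exact: sqrnormZ.
Qed.

Lemma opnorm_leP (T : {linear H -> K}) (r : R) : 0 <= r ->
  (opnorm T <= r%:E)%E <-> forall x, hnorm (T x) <= r * hnorm x.
Proof.
move=> r0; split=> [Tr x|Tr].
  have [x0|x0] := eqVneq (hnorm x) 0.
    have -> : x = 0 by apply/eqP; rewrite -sqrnorm_eq0 -sqr_hnorm x0 expr0n.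
    have z (L : hilbertType R) : hnorm (0 : L) = 0.
      by apply/eqP; rewrite -sqrf_eq0 sqr_hnorm sqrnorm0.
    by rewrite linear0 !z mulr0.
  have x_gt0 : 0 < hnorm x by rewrite lt_neqAle eq_sym x0 hnorm_ge0.
  pose c : R[i] := ((hnorm x)^-1)%:C%C.
  have cE : Num.sqrt (sqrmod c) = (hnorm x)^-1.
    by rewrite /sqrmod /= expr0n addr0 sqrtr_sqr ger0_norm// invr_ge0 ltW.
  have : ((hnorm (T (c *: x)))%:E <= r%:E)%E.
    apply: le_trans Tr; apply: ereal_sup_ubound; exists (c *: x) => //=.
    by rewrite hnormZ cE mulVf.
  rewrite lee_fin linearZZ.
  rewrite /hnorm /dot_norm -!/(sqrnorm _) sqrnormZ sqrtrM ?sqrmod_ge0// cE.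
  by rewrite mulrC ler_pdivrMr.
apply: ge_ereal_sup => _ [x /= x1 <-]; rewrite lee_fin.
by apply: le_trans (Tr x) _; rewrite ler_piMr.
Qed.

End OperatorNorm.

Lemma contraction_contractive (R : realType) (H : hilbertType R)
  (T : {linear H -> H}) : contraction_op T -> contractive T.
Proof.
by move=> /(opnorm_leP _ ler01) cT x; rewrite -ler_hnorm -[leRHS]mul1r.
Qed.

Lemma opnorm_scale_le (R : realType) (H : hilbertType R) (c : R[i])
    (T B : {linear H -> H}) (x0 : H) :
  (forall x, T x = c *: B x) -> contractive B -> B x0 != 0 ->
  (opnorm T <= opnorm B)%E -> sqrmod c <= 1.
Proof.
move=> TE cB Bx0 TB.
have B1 : (opnorm B <= 1%:E)%E.
  by apply/(opnorm_leP _ ler01) => x; rewrite mul1r ler_hnorm.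
have B0 : (0 <= opnorm B)%E.
  apply: ereal_sup_ge => /=; exists (hnorm (B 0))%:E;
    last by rewrite lee_fin hnorm_ge0.
  exists 0 => //=; rewrite -(@ler_pXn2r _ 2) ?nnegrE ?hnorm_ge0//.
  by rewrite sqr_hnorm sqrnorm0 expr1n.
have Bfin : opnorm B \is a fin_num.
  by rewrite ge0_fin_numE//; apply: le_lt_trans B1 _; exact: ltry.
pose r := fine (opnorm B); have BE : opnorm B = r%:E by rewrite /r fineK.
have r0 : 0 <= r by rewrite -lee_fin -BE.
have Br : forall x, hnorm (B x) <= r * hnorm x.
  by apply/(opnorm_leP _ r0); rewrite BE.
have Tr : forall x, hnorm (T x) <= r * hnorm x.
  by apply/(opnorm_leP _ r0); rewrite -BE.
rewrite leNgt; apply/negP => c1.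
pose k := Num.sqrt (sqrmod c).
have k1 : 1 < k by rewrite -sqrtr1 ltr_sqrt// (lt_trans ltr01).
have k0 : 0 < k := lt_trans ltr01 k1.
have : (opnorm B <= (r / k)%:E)%E.
  apply/opnorm_leP => [|x]; first by rewrite divr_ge0// ltW.
  by rewrite mulrAC ler_pdivlMr// mulrC -hnormZ -TE.
rewrite BE lee_fin ler_pdivlMr// => rk.
have r_eq0 : r = 0.
  apply/eqP; rewrite eq_le r0 andbT -(@pmulr_lle0 _ (k - 1)) ?subr_gt0//.
  by rewrite mulrBr mulr1 subr_le0.
have := Br x0; rewrite r_eq0 mul0r => Bx; move/negP: Bx0; apply.
rewrite -sqrnorm_eq0 -sqr_hnorm sqrf_eq0 eq_le Bx hnorm_ge0//.
Qed.

Lemma isometric_factors (R : realType) (H : hilbertType R)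
    (T S : {linear H -> H}) (c : R[i]) (T' S' : {linear H -> H}) :
  contractive T -> contractive S -> 1 <= sqrmod c ->
  (forall x, T (S (T (S x))) = c *: x) ->
  cancel T' T -> cancel S' S ->
  (forall x, sqrnorm (T x) = sqrnorm x) /\ (forall x, sqrnorm (S x) =
    sqrnorm x).
Proof.
move=> cT cS c1 TSc T'K S'K.
have lb x : sqrnorm x <= sqrnorm (T (S (T (S x)))).
  by rewrite TSc sqrnormZ ler_peMl// sqrnorm_ge0.
split=> x; apply/eqP; rewrite eq_le ?cT ?cS /=; last first.
  by apply: le_trans (lb x) _; rewrite (le_trans (cT _))// (le_trans (cS _)).
set y := S' (T' (S' x)).
have xE : x = S (T (S y)) by rewrite /y S'K T'K S'K.
rewrite {2}xE; apply: le_trans (lb y); rewrite xE.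
by rewrite (le_trans (cS _))// (le_trans (cT _)).
Qed.

Section OperatorMatrix.
Variable R : realType.

Definition opmx (T : {linear Cn R 2 -> Cn R 2}) : 'M[R[i]]_2 :=
  lin1_mx (T : 'rV[R[i]]_2 -> 'rV[R[i]]_2).

Lemma opmxE (T : {linear Cn R 2 -> Cn R 2}) x : T x = mxop (opmx T) x.
Proof. by rewrite -[RHS]/(x *m opmx T) mul_rV_lin1. Qed.

Lemma opmx_comp (T S : {linear Cn R 2 -> Cn R 2}) (x : 'rV[R[i]]_2) :
  T (S x) = x *m (opmx S *m opmx T).
Proof. by rewrite (opmxE T) (opmxE S); exact: (esym (mulmxA _ _ _)). Qed.

Lemma opmx_ext (A B : 'M[R[i]]_2) : (forall x :
  'rV_2, x *m A = x *m B) -> A = B.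
Proof. by move=> AB; apply/row_matrixP => i; rewrite !rowE. Qed.

Lemma opmx_anticommute (T S : {linear Cn R 2 -> Cn R 2}) :
  (forall x, T (S x) = - S (T x)) ->
  opmx S *m opmx T = - (opmx T *m opmx S).
Proof. by move=> TS; apply: opmx_ext => x; rewrite mulmxN -!opmx_comp. Qed.

Lemma opmx_unit (T S : {linear Cn R 2 -> Cn R 2}) :
  cancel S T -> opmx T \in unitmx.
Proof.
move=> ST; suff /mulmx1_unit[] : opmx S *m opmx T = 1%:M by [].
by apply: opmx_ext => x; rewrite -opmx_comp ST mulmx1.
Qed.

End OperatorMatrix.

Section Assembly.
Variables (R : realType) (T1 T2 T3 : {linear Cn R 2 -> Cn R 2}).
Hypothesis ac : anticommuting [tuple T1; T2; T3].
Variables (S1 S2 S3 : {linear Cn R 2 -> Cn R 2}).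
Hypotheses (S1K : cancel S1 T1) (S2K : cancel S2 T2) (S3K : cancel S3 T3).
Hypotheses (T1K : cancel T1 S1) (T2K : cancel T2 S2) (T3K : cancel T3 S3).

Let M := opmx T2. Let N := opmx T3. Let L := opmx T1.
Let A := N *m M.
Let uM : M \in unitmx := opmx_unit S2K.
Let uN : N \in unitmx := opmx_unit S3K.
Let uA : A \in unitmx. Proof. by rewrite unitmx_mul uN uM. Qed.

Let MN : M *m N = - (N *m M).
Proof.
have /anticommuting3P[_ _ h] := ac.
by rewrite [N *m M](opmx_anticommute h) opprK.
Qed.

Let AM : A *m M = - (M *m A).
Proof. by rewrite /A mulmxA MN mulNmx opprK. Qed.

Let AN : A *m N = - (N *m A).
Proof. by rewrite /A -mulmxA MN mulmxN mulmxA. Qed.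

Lemma product_sqr_scalar : exists c, (N *m M) *m (N *m M) = c%:M.
Proof.
apply: (anticommuting_irreducible uM uN MN); rewrite -/A.
  by rewrite -(mulmxA A A) AM mulmxN (mulmxA A M) AM mulNmx opprK -(mulmxA M A).
by rewrite -(mulmxA A A) AN mulmxN (mulmxA A N) AN mulNmx opprK -(mulmxA N A).
Qed.

Lemma first_eq_scaled_product : exists c, forall x, T1 x = c *: T2 (T3 x).
Proof.
have /anticommuting3P[h2 h3 _] := ac.
have ML : M *m L = - (L *m M) := opmx_anticommute h2.
have NL : N *m L = - (L *m N) := opmx_anticommute h3.
have inv X : A *m X = - (X *m A) -> invmx A *m X = - (X *m invmx A).
  move=> AX; have : invmx A *m (A *m X) *m invmx A =
    invmx A *m (- (X *m A)) *m invmx A.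
    by rewrite AX.
  by rewrite mulKmx// mulmxN mulNmx mulmxA mulmxK// => ->; rewrite opprK.
have [||c LA] := @anticommuting_irreducible _ M N (L *m invmx A) uM uN MN.
- by rewrite -(mulmxA L) (inv _ AM) mulmxN (mulmxA M L) ML mulNmx (mulmxA L M).
- by rewrite -(mulmxA L) (inv _ AN) mulmxN (mulmxA N L) NL mulNmx (mulmxA L N).
exists c => x; rewrite opmx_comp -/A (opmxE T1) -[LHS]/(x *m L).
by rewrite -(mulmxKV uA L) LA mul_scalar_mx -scalemxAr.
Qed.

Hypotheses (cT2 : contractive T2) (cT3 : contractive T3).

Lemma pair_dilation : exists (K : hilbertType R) (U2 U3 : {linear K -> K}),
  [/\ forall x, U2 (U3 x) = - U3 (U2 x), unitary_op U2, unitary_op U3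
    & weak_dilates [tuple (U2 \o U3 : {linear K -> K}); U2; U3]
        [tuple (T2 \o T3 : {linear Cn R 2 -> Cn R 2}); T2; T3]].
Proof.
have [c cE] := product_sqr_scalar.
have [c1|c1] := ltP (sqrmod c) 1.
  apply: (@pure_pair_dilation R T2 T3 M N c) => //; try exact: opmxE.
  by rewrite MN opprK.
have cE' x : T2 (T3 (T2 (T3 x))) = c *: x.
  rewrite (opmx_comp T2 T3 (T2 (T3 x))) (opmx_comp T2 T3 x).
  by apply: etrans (esym (mulmxA _ _ _)) _; rewrite cE; exact: mul_mx_scalar.
have [i2 i3] := isometric_factors cT2 cT3 c1 cE' S2K S3K.
exists (Cn R 2), T2, T3; split.
- by have /anticommuting3P[] := ac.
- exact: unitary_isometry_bij i2 S2K T2K.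
- exact: unitary_isometry_bij i3 S3K T3K.
- exact: weak_dilates_refl.
Qed.

End Assembly.

Theorem theorem2p6 (R : realType) (T1 T2 T3 : {linear Cn R 2 -> Cn R 2}) :
  anticommuting [tuple T1; T2; T3] ->
  contraction_op T1 -> contraction_op T2 -> contraction_op T3 ->
  invertible_op T1 -> invertible_op T2 -> invertible_op T3 ->
  (exists (K : hilbertType R) (U1 U2 U3 : {linear K -> K}) (beta : R[i]),
     anticommuting [tuple U1; U2; U3] /\
     unitary_op U1 /\ unitary_op U2 /\ unitary_op U3 /\
     beta != 0 /\
     dilates [tuple (beta \*: U1 : {linear K -> K}); U2; U3]
             [tuple T1; T2; T3]) /\
  ((opnorm T1 <= opnorm (T2 \o T3 : {linear Cn R 2 -> Cn R 2}))%E ->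
   exists (K : hilbertType R) (U1 U2 U3 : {linear K -> K}),
     anticommuting [tuple U1; U2; U3] /\
     unitary_op U1 /\ unitary_op U2 /\ unitary_op U3 /\
     dilates [tuple U1; U2; U3] [tuple T1; T2; T3]).
Proof.
move=> ac _ /contraction_contractive cT2 /contraction_contractive cT3.
move=> [S1 [_ S1K T1K]] [S2 [_ S2K T2K]] [S3 [_ S3K T3K]].
have [c T1E] := first_eq_scaled_product ac S2K S3K.
have [K [U2 [U3 [U23 uU2 uU3 dil]]]] :=
  pair_dilation ac S2K S3K T2K T3K cT2 cT3.
pose U1 : {linear K -> K} := U2 \o U3.
have acU : anticommuting [tuple U1; U2; U3] := anticommuting_product U23.
have uU1 : unitary_op U1 := unitary_comp uU2 uU3.
have wd : weak_dilates [tuple (c \*: U1 : {linear K -> K}); U2; U3] [tuple T1;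
  T2; T3].
  by apply: weak_dilates_scale dil.
pose x0 : Cn R 2 := (const_mx 1 : 'rV[R[i]]_2).
have x0_neq0 : x0 != 0.
  by apply/eqP => /rowP/(_ ord0)/eqP; rewrite !mxE oner_eq0.
have T1x0 : T1 x0 != 0.
  by apply: contraNneq x0_neq0 => Tx; rewrite -(T1K x0) Tx linear0.
split=> [|T123].
  exists K, U1, U2, U3, c; do 5?split => //; last exact: weak_dilates_dilates.
  by apply: contraNneq T1x0 => c0; rewrite T1E c0 scale0r.
have c1 : sqrmod c <= 1.
  apply: (opnorm_scale_le (x0 := x0) _ _ _ T123) => [//|x|].
    exact: le_trans (cT2 _) (cT3 x).
  by apply: contraNneq T1x0 => Bx; rewrite T1E; move: Bx => /= ->;
    rewrite scaler0.
have [L [W1 [W2 [W3 [acW [uW1 uW2 uW3] Wdil]]]]] :=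
  scaled_unitary_dilation c1 acU uU1 uU2 uU3.
exists L, W1, W2, W3; do 4?split => //.
exact/weak_dilates_dilates/(weak_dilates_trans Wdil wd).
Qed.
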